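(* Let $\lambda=(\lambda_1\ge\dots\ge\lambda_n\ge0)$ be a partition with at most $n$ parts, and let $\mathbf{x}=(x_1,\dots,x_n)$ and $\mathbf{t}=(t_1,\dots,t_n)$ be commuting indeterminates. The partition function $Z(\mathfrak{G}_\lambda;\mathbf{x},\mathbf{t})$ of the vertex model $\mathfrak{G}_\lambda$ is the refined Grothendieck polynomial $G_\lambda(\mathbf{x};\mathbf{t})$.
   Context: **Refined Grothendieck polynomial.** A (semistandard) set-valued tableau of shape $\lambda$ is a filling of the boxes of $\lambda$ (English convention, row 1 at the top) with finite non-empty sets of positive integers such that if box $B$ is immediately to the right of box $A$ then $\max A\le\min B$, and if box $C$ is immediately below box $A$ then $\max A<\min C$. Let $\mathrm{SVT}^n(\lambda)$ be the set of those with all entries at most $n$. For such $T$, let $e_i$ be the number of extra entries in row $i$ (total number of integers in row $i$ minus the number of boxes in row $i$), and let $\mathbf{x}^T=\prod_k x_k^{c_k}$ where $c_k$ is the number of occurrences of $k$ in $T$. Then $G_\lambda(\mathbf{x};\mathbf{t}):=\sum_{T\in\mathrm{SVT}^n(\lambda)}\prod_i(-t_i)^{e_i}\,\mathbf{x}^T$. **The model $\mathfrak{G}_\lambda$.** It consists of vertices on left-aligned rows of a square grid, with columns numbered $1,2,\dots$ from the left. The bottom $n$ rows (rectangular part) each have $\lambda_1+n$ vertices, and the $i$-th row from the bottom has spectral parameter $x_i$. On top of these are $n-1$ further rows (jagged part); for $1\le i\le n-1$ the $(n+i)$-th row from the bottom has $\lambda_i+n-i$ vertices and spectral parameter $-t_i$.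 Edges and half-edges are labeled $0$ or $1$. Boundary conditions: all left and right boundary half-edges are $0$; the bottom half-edges of columns $1,\dots,n$ are $1$ and the remaining bottom half-edges are $0$; the top boundary half-edge of column $c$ (above the topmost vertex of that column) is $1$ if $c=\lambda_i+n+1-i$ for some $1\le i\le n$, and $0$ otherwise. **Boltzmann weights.** Labels around a vertex are listed as (top, right, bottom, left), and $z$ is the spectral parameter of the row. In the rectangular part: $(0,0,0,0)\mapsto1$; $(1,0,1,0)\mapsto1$; $(0,1,0,1)\mapsto z$; $(1,0,0,1)\mapsto z$; $(0,1,1,0)\mapsto1$; all others $0$. In the jagged part: $(0,0,0,0)\mapsto1$; $(1,1,1,1)\mapsto z$; $(1,0,1,0)\mapsto1$; $(0,0,1,1)\mapsto1$; $(1,1,0,0)\mapsto z$; all others $0$. A state is a labeling of all edges compatible with the boundary conditions in which every vertex has non-zero weight; its weight is the product of its vertex weights; the partition function is the sum of the weights of all states. *)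

(* Defs.v *)
From HB Require Import structures.
From mathcomp Require Import all_boot all_order all_algebra.
From mathcomp Require Import mpoly.

Set Implicit Arguments.
Unset Strict Implicit.
Unset Printing Implicit Defensive.

Import GRing.Theory.
Local Open Scope ring_scope.

(* Every index (part, row, column, variable, tableau entry) starts at 0: the
   part [part lam i], the variables [x`_i], [t`_i] and the row [i] are the
   mathematical lambda_(i+1), x_(i+1), t_(i+1) and row i+1, and a tableau entry
   [k : 'I_n] stands for the positive integer k+1. *)

Definition part n (lam : n.-tuple nat) (i : nat) : nat := nth 0%N lam i.

Definition is_partition n (lam : n.-tuple nat) : bool := sorted geq lam.

Definition boxes n (lam : n.-tuple nat) : seq (nat * nat) :=
  [seq (i, j) | i <- iota 0 n, j <- iota 0 (part lam i)].

Notation filling n lam := {ffun seq_sub (boxes lam) -> {set 'I_n}}.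

(* These are the maximum and the minimum when [A] is nonempty. *)
Definition set_max n (A : {set 'I_n}) : nat := (\max_(k in A) k)%N.
Definition set_min n (A : {set 'I_n}) : nat := \big[minn/n]_(k in A) k.

Definition is_svt n (lam : n.-tuple nat) (T : filling n lam) : bool :=
  [&& [forall A, T A != set0],
      [forall A, forall B,
         (val B == ((val A).1, (val A).2.+1)) ==>
         (set_max (T A) <= set_min (T B))%N]
    & [forall A, forall C,
         (val C == ((val A).1.+1, (val A).2)) ==>
         (set_max (T A) < set_min (T C))%N]].

Definition excess n (lam : n.-tuple nat) (T : filling n lam) (i : nat) : nat :=
  ((\sum_(A : seq_sub (boxes lam) | (val A).1 == i) #|T A|)
     - #|[pred A : seq_sub (boxes lam) | (val A).1 == i]|)%N.

Definition occurrences n (lam : n.-tuple nat) (T : filling n lam) (k : 'I_n) : nat :=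
  #|[set A | k \in T A]|.

Definition refined_grothendieck (R : comNzRingType) n (lam : n.-tuple nat)
    (x t : n.-tuple R) : R :=
  \sum_(T : filling n lam | is_svt T)
    (\prod_(i < n) (- t`_i) ^+ excess T i) *
    (\prod_(k < n) x`_k ^+ occurrences T k).

(* Rows are counted from the bottom: rows r < n form the rectangular part and
   rows n + i, i < n - 1, the jagged part. *)
Definition row_length n (lam : n.-tuple nat) (r : nat) : nat :=
  if (r < n)%N then (part lam 0 + n)%N
  else (part lam (r - n) + n - (r - n).+1)%N.

Definition vertices n (lam : n.-tuple nat) : seq (nat * nat) :=
  [seq (r, c) | r <- iota 0 (n + n.-1), c <- iota 0 (row_length lam r)].

(* Edges include the boundary half-edges.  The horizontal edge (r, c) is to the
   left of the vertex (r, c) and to the right of the vertex (r, c - 1); the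
   vertical edge (r, c) is below (r, c) and above (r - 1, c). *)
Definition hedges n (lam : n.-tuple nat) : seq (nat * nat) :=
  vertices lam ++ [seq (v.1, v.2.+1) | v <- vertices lam].

Definition vedges n (lam : n.-tuple nat) : seq (nat * nat) :=
  vertices lam ++ [seq (v.1.+1, v.2) | v <- vertices lam].

Notation labeling lam :=
  ({ffun seq_sub (hedges lam) -> bool} * {ffun seq_sub (vedges lam) -> bool})%type.

(* The default [false] is never used at the edges around a vertex. *)
Definition edge_label (E : seq (nat * nat)) (f : {ffun seq_sub E -> bool})
    (e : nat * nat) : bool :=
  if insub e is Some e' then f e' else false.

Definition top_label n (lam : n.-tuple nat) (s : labeling lam) (v : nat * nat) :=
  edge_label s.2 (v.1.+1, v.2).
Definition right_label n (lam : n.-tuple nat) (s : labeling lam) (v : nat * nat) :=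
  edge_label s.1 (v.1, v.2.+1).
Definition bottom_label n (lam : n.-tuple nat) (s : labeling lam) (v : nat * nat) :=
  edge_label s.2 v.
Definition left_label n (lam : n.-tuple nat) (s : labeling lam) (v : nat * nat) :=
  edge_label s.1 v.

Definition rect_weight (R : comNzRingType) (z : R)
    (top right bottom left : bool) : R :=
  match top, right, bottom, left with
  | false, false, false, false => 1
  | true,  false, true,  false => 1
  | false, true,  false, true  => z
  | true,  false, false, true  => z
  | false, true,  true,  false => 1
  | _, _, _, _ => 0
  end.

Definition jagged_weight (R : comNzRingType) (z : R)
    (top right bottom left : bool) : R :=
  match top, right, bottom, left with
  | false, false, false, false => 1
  | true,  true,  true,  true  => z
  | true,  false, true,  false => 1
  | false, false, true,  true  => 1
  | true,  true,  false, false => z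
  | _, _, _, _ => 0
  end.

Definition vertex_weight (R : comNzRingType) n (lam : n.-tuple nat)
    (x t : n.-tuple R) (s : labeling lam) (v : nat * nat) : R :=
  (if (v.1 < n)%N then rect_weight x`_(v.1) else jagged_weight (- t`_(v.1 - n)))
    (top_label s v) (right_label s v) (bottom_label s v) (left_label s v).

(* In 0-based columns, the top half-edges labeled 1 are those of the columns
   part lam i + n - 1 - i for i < n. *)
Definition boundary_ok n (lam : n.-tuple nat) (s : labeling lam) : bool :=
  all (fun v =>
    [&& (v.2 == 0%N) ==> (left_label s v == false),
        ((v.1, v.2.+1) \notin vertices lam) ==> (right_label s v == false),
        (v.1 == 0%N) ==> (bottom_label s v == (v.2 < n)%N)
      & ((v.1.+1, v.2) \notin vertices lam) ==>
          (top_label s v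
             == [exists i : 'I_n, v.2 == (part lam i + n - i.+1)%N])])
    (vertices lam).

Definition is_state (R : comNzRingType) n (lam : n.-tuple nat)
    (x t : n.-tuple R) (s : labeling lam) : bool :=
  boundary_ok s && all (fun v => vertex_weight x t s v != 0) (vertices lam).

Definition partition_function (R : comNzRingType) n (lam : n.-tuple nat)
    (x t : n.-tuple R) : R :=
  \sum_(s : labeling lam | is_state x t s)
    \prod_(v <- vertices lam) vertex_weight x t s v.

(* The 2n indeterminates of Z[x_1, ..., x_n, t_1, ..., t_n]. *)
Definition x_vars n : n.-tuple {mpoly int[n + n]} :=
  [tuple 'X_(lshift n i) | i < n].
Definition t_vars n : n.-tuple {mpoly int[n + n]} :=
  [tuple 'X_(rshift n i) | i < n].

(* Main.v *)
(* Both sides equal the Jacobi-Trudi type determinant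
     H_n(lam) = det [ sum_s c_(j,s) h_(lam_j + s - j + i)(x_1, ..., x_n) ],
   where prod_(k < j) (1 - t_k X) = sum_s c_(j,s) X^s.

   Lattice side: to a configuration of n particles in columns attach the wedge of
   the vectors g_c over the occupied columns c, evaluated by an alternating
   multilinear functional.  Summing over the lower configurations of a row,
   column by column, again gives such a wedge, with g_c replaced by
   g_c + z g_(c-1) + z^2 g_(c-2) + ... in a rectangular row and by g_c + z g_(c+1)
   in a jagged row (for the columns which the row contains).  Starting from
   g_c = X^c, the n rectangular rows produce the complete symmetric functions and
   the jagged rows the factors 1 - t_k X.

   Tableau side: removing the largest label m from a set-valued tableau of shape
   lam leaves one of shape mu, where lam / mu is a horizontal strip, and label m
   may or may not also occur in the last box of each row i of mu with
   mu_i > lam_(i+1).  This gives the branching rule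
     G_lam = sum_mu x_m^|lam / mu| prod_(i : mu_i > lam_(i+1)) (1 - t_i x_m) G_mu,
   which the determinants satisfy by column operations. *)
Require Import Defs.
From mathcomp Require Import all_boot all_order all_algebra.
From mathcomp Require Import mpoly.
From HB Require Import structures.
From mathcomp Require Import fingroup perm ring zify.

Set Implicit Arguments.
Unset Strict Implicit.
Unset Printing Implicit Defensive.

Import GRing.Theory.
Local Open Scope ring_scope.


(** * Jacobi-Trudi determinants *)

(* [resolv z] is the inverse of [1 - z S], where [S = drop_poly 1] forgets the
   constant coefficient and divides by ['X]; composing the [resolv x_i] gives the
   operator whose matrix in the powers of ['X] consists of the complete symmetric
   functions of the [x_i]. *)
Section Resolvent.
Variables (R : comNzRingType) (z : R).
Implicit Types f g : {poly R}.

Definition resolv f : {poly R} :=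
  \poly_(k < size f) \sum_(j < size f) z ^+ j * f`_(k + j).

Lemma coef_resolv f k : (resolv f)`_k = \sum_(j < size f) z ^+ j * f`_(k + j).
Proof.
rewrite coef_poly; case: ltnP => // le_fk.
by rewrite big1 // => j _; rewrite nth_default ?mulr0 // (leq_trans le_fk) ?leq_addr.
Qed.

Lemma resolvE f : resolv f = f + z *: drop_poly 1 (resolv f).
Proof.
apply/polyP => k; rewrite coefD coefZ coef_drop_poly !coef_resolv.
transitivity (\sum_(j < (size f).+1) z ^+ j * f`_(k + j)).
  by rewrite big_ord_recr /= [f`_(k + _)]nth_default ?leq_addl // mulr0 addr0.
rewrite big_ord_recl addn0 mul1r; congr (_ + _); rewrite mulr_sumr.
by apply: eq_bigr => j _; rewrite mulrA -exprS addn1 addSnnS.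
Qed.

(** The difference d of two solutions satisfies d = z S d, hence d = z^m S^m d for every m, and S^m
    kills d once m reaches its size. *)
Lemma resolv_uniq f g : g = f + z *: drop_poly 1 g -> g = resolv f.
Proof.
move=> gE; set h := resolv f.
have dE : g - h = z *: drop_poly 1 (g - h).
  by rewrite {1}gE {1}/h resolvE linearB scalerBr opprD addrACA subrr add0r.
have dEn m : g - h = z ^+ m *: drop_poly m (g - h).
  elim: m => [|m IHm]; first by rewrite scale1r drop_poly0l.
  rewrite {1}dE {1}IHm linearZ /= scalerA -exprS.
  by congr (_ *: _); apply/polyP => k; rewrite !coef_drop_poly -addnA.
apply/eqP; rewrite -subr_eq0 (dEn (size (g - h))) drop_poly_eq0 // scaler0.
exact: eqxx.
Qed.

Lemma resolvZD a f g : resolv (a *: f + g) = a *: resolv f + resolv g.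
Proof.
apply/esym/resolv_uniq; rewrite {1}(resolvE f) {1}(resolvE g) drop_polyD drop_polyZ.
by rewrite !scalerDr !scalerA addrACA (mulrC a).
Qed.

Lemma drop_resolv f : drop_poly 1 (resolv f) = resolv (drop_poly 1 f).
Proof. by apply: resolv_uniq; rewrite {1}resolvE drop_polyD drop_polyZ. Qed.

Lemma resolv_coef0 f : (resolv f)`_0 = f.[z].
Proof.
rewrite coef_resolv horner_coef; apply: eq_bigr => j _.
by rewrite add0n mulrC.
Qed.

Lemma resolvXS c : resolv ('X^(c.+1)) = 'X^(c.+1) + z *: resolv 'X^c.
Proof.
rewrite {1}resolvE drop_resolv; congr (_ + _ *: resolv _).
by apply/polyP => k; rewrite coef_drop_poly !coefXn addn1 eqSS.
Qed.

Lemma resolv1 : resolv 1 = 1.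
Proof.
apply/esym/resolv_uniq; rewrite drop_poly_eq0 ?size_poly1 // scaler0 addr0 //.
Qed.

End Resolvent.

HB.instance Definition _ (R : comNzRingType) (z : R) :=
  GRing.isLinear.Build R {poly R} {poly R} _ (resolv z) (resolvZD z).

Section Resolvents.
Variables (R : comNzRingType) (x : nat -> R).
Implicit Types (f g : {poly R}) (m : nat).

Fixpoint resolvs m f : {poly R} :=
  if m is m'.+1 then resolvs m' (resolv (x m') f) else f.

Lemma resolvsZD m a f g : resolvs m (a *: f + g) = a *: resolvs m f + resolvs m g.
Proof. by elim: m f g => //= m IHm f g; rewrite resolvZD IHm. Qed.

Lemma drop_resolvs m f : drop_poly 1 (resolvs m f) = resolvs m (drop_poly 1 f).
Proof. by elim: m f => //= m IHm f; rewrite IHm drop_resolv. Qed.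

End Resolvents.

HB.instance Definition _ (R : comNzRingType) x m :=
  GRing.isLinear.Build R {poly R} {poly R} _ (@resolvs R x m) (@resolvsZD R x m).

Section JacobiTrudi.
Variables (R : comNzRingType) (x t : nat -> R).
Implicit Types (f g : {poly R}) (m : nat) (lam : nat -> nat).

(* The coefficients of [prod_(k < m) (1 - x_k X)] invert those of the complete
   symmetric functions, so they single out the constant coefficient. *)
Lemma resolvs_coef0 m : exists2 a : nat -> R, a 0%N = 1 &
  forall f, \sum_(k < m.+1) a k * (resolvs x m f)`_k = f`_0.
Proof.
elim: m => [|m [a a0 aP]].
  by exists (fun=> 1) => // f; rewrite big_ord1 mul1r.
(* The coefficients of the previous polynomial multiplied by 1 - x_m X; the test [k <= m] discards
   the values of [a] beyond index m, about which nothing is known. *)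
exists (fun k => (if (k <= m)%N then a k else 0) - (if k is k'.+1 then x m * a k' else 0)) => [|f].
  by rewrite a0 subr0.
set g := resolv (x m) f.
have fE : f = g - x m *: drop_poly 1 g by rewrite {1}/g resolvE addrK.
rewrite /= -/g [in RHS]fE -aP linearB linearZ /= -drop_resolvs.
under eq_bigr => k _ do rewrite mulrBl.
under [RHS]eq_bigr => k _ do rewrite coefB coefZ coef_drop_poly mulrBr.
rewrite !sumrB; congr (_ - _).
  rewrite big_ord_recr /= ltnn mul0r addr0; apply: eq_bigr => k _.
  by rewrite -ltnS ltn_ord.
rewrite big_ord_recl mul0r add0r; apply: eq_bigr => k _.
by rewrite /= addn1 mulrCA mulrA.
Qed.

Definition tfactor j : {poly R} := \prod_(k < j) (1 - t k *: 'X).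

Definition jt_mx m (f : nat -> {poly R}) : 'M[R]_m :=
  \matrix_(i, j) (resolvs x m (f j))`_(m - i.+1).

(** Since [resolvs x m] maps X^a to the sum over k of h_(a-k)(x_0, ..., x_(m-1)) X^k, the entry (i,
    j) is the sum over s of c_(j,s) h_(lam_j + s - j + i). *)
Definition jt_det m lam : R :=
  \det (jt_mx m (fun j => 'X^(lam j + (m - j.+1)) * tfactor j)).

End JacobiTrudi.

Section Determinants.
Variables (R : comNzRingType) (x : nat -> R).
Implicit Types (f g : {poly R}) (m : nat).

(** [A'] is [A] times a lower bidiagonal matrix with diagonal [c]. *)
Lemma det_colop m (A : 'M[R]_m) (b c : nat -> R) (A' : 'M[R]_m) :
  (forall i j k : 'I_m, k = j.+1 :> nat -> A' i j = c j * A i j + b j * A i k) ->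
  (forall i j : 'I_m, j.+1 = m -> A' i j = c j * A i j) ->
  \det A' = (\prod_(j < m) c j) * \det A.
Proof.
move=> A'S A'max.
pose C : 'M[R]_m := \matrix_(k, j)
  if k == j then c j else if k == j.+1 :> nat then b j else 0.
have -> : A' = A *m C.
  apply/matrixP => i j; rewrite mxE (bigD1 j) //= mxE eqxx.
  have [jm | mj] := ltnP j.+1 m.
    rewrite (A'S _ _ (Ordinal jm)) // (bigD1 (Ordinal jm)) /=; last first.
      by rewrite -(inj_eq val_inj) /= neq_ltn ltnSn orbT.
    rewrite mxE /= eqxx -(inj_eq val_inj) /= gtn_eqF ?ltnSn // big1 ?addr0.
      by rewrite !(mulrC (A _ _)).
    move=> k /andP [/negPf kj]; rewrite mxE kj -(inj_eq val_inj) /= => /negPf ->.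
    by rewrite mulr0.
  rewrite A'max ?big1 ?addr0; first by rewrite mulrC.
    move=> k /negPf kj; rewrite mxE kj.
    by have := ltn_ord k; case: eqP; [lia | rewrite mulr0].
  by have := ltn_ord j; lia.
rewrite det_mulmx mulrC; congr (_ * _); rewrite det_trig.
  by apply: eq_bigr => j _; rewrite mxE eqxx.
apply/is_trig_mxP => i j ij; rewrite mxE -(inj_eq val_inj).
by rewrite /= ltn_eqF //; case: eqP => //; lia.
Qed.

(* By [resolvs_coef0] a combination of the rows of this matrix is the row of the
   constant coefficients of the [f j], which is zero except at [j = m]. *)
Lemma det_jt_reduce m (f g : nat -> {poly R}) :
  (forall j, (j < m)%N -> f j = g j * 'X) ->
  \det (\matrix_(i < m.+1, j < m.+1) (resolvs x m (f j))`_(m - i))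
    = (f m)`_0 * \det (jt_mx x m g).
Proof.
move=> fE; have [a a0 aP] := resolvs_coef0 x m.
set M := (X in \det X).
(* The identity matrix with its last row replaced by the values of [a] in reverse order, as row [k]
   of [M] reads the coefficient of index [m - k]; [a 0 = 1] makes it unitriangular. *)
pose C : 'M[R]_m.+1 := \matrix_(i, k)
  if i == ord_max then a (m - k)%N else (i == k)%:R.
have detC : \det C = 1.
  rewrite det_trig ?big1 // => [i _|].
    by rewrite mxE eqxx; case: eqP => // ->; rewrite subnn.
  apply/is_trig_mxP => i j ij; rewrite mxE -!(inj_eq val_inj) /=.
  have := ltn_ord j; case: eqP => [|_]; first lia.
  by rewrite ltn_eqF.
rewrite -[LHS]mul1r -detC -det_mulmx.
have CM_max j : (C *m M) ord_max j = (f j)`_0.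
  rewrite mxE -aP (reindex_inj rev_ord_inj); apply: eq_bigr => k _.
  by rewrite !mxE eqxx /= subSS subKn // -ltnS.
have CM i j : i != ord_max -> (C *m M) i j = M i j.
  move=> /negPf i_max; rewrite mxE (bigD1 i) //= mxE i_max eqxx mul1r big1 ?addr0 //.
  by move=> k /negPf ki; rewrite mxE i_max eq_sym ki mul0r.
rewrite (expand_det_row _ ord_max) (bigD1 ord_max) //= CM_max big1 ?addr0.
  rewrite /cofactor -signr_odd addnn odd_double mul1r; congr (_ * \det _).
  apply/matrixP => i j; rewrite [LHS]mxE [LHS]mxE CM; last first.
    by rewrite -(inj_eq val_inj) /= /bump leqNgt ltn_ord /= neq_ltn ltn_ord.
  rewrite !mxE.
  rewrite !lift_max fE //.
  have -> : (m - i = (m - i.+1).+1)%N by have := ltn_ord i; lia.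
  (* Dropping the constant coefficient commutes with [resolvs] and cancels the factor X of the
     column. *)
  rewrite -addn1 -coef_drop_poly drop_resolvs.
  by rewrite -['X]expr1 drop_polyMXn_id.
move=> j j_max; rewrite CM_max fE; last first.
  have := ltn_ord j; move: j_max; rewrite -(inj_eq val_inj) /=; lia.
by rewrite coefMX mul0r.
Qed.

(** Multiplication by X - y telescopes the sum. With a = lam_(j+1), a + d = lam_j and u = mu_j, the
    coefficients are the weights of row j in the branching rule, so the sum is the quotient by X - y
    of a combination of two adjacent columns. *)
Lemma strip_telescope (y s : R) a d :
  ('X - y%:P) * (\sum_(a <= u < (a + d).+1)
     (y ^+ (a + d - u) * (if (a < u)%N then 1 - s * y else 1)) *: 'X^u)
  = (1 - s * y) *: 'X^((a + d).+1) - y ^+ d.+1 *: ('X^a * (1 - s *: 'X)) :> {poly R}.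
Proof.
elim: d => [|d IHd].
  rewrite addn0 big_nat1 ltnn subnn mulr1.
  rewrite -!mul_polyC !polyC_exp !(polyCM, polyCB, polyC1) !exprS expr0.
  by ring.
rewrite addnS big_nat_recr; last by rewrite leqW ?leq_addr.
rewrite ltnS leq_addr subnn mul1r.
under eq_big_nat => u /andP [_ u_le] do
  rewrite subSn // exprS -mulrA -scalerA.
rewrite -scaler_sumr mulrDr -scalerAr IHd.
rewrite -!mul_polyC !polyC_exp !(polyCM, polyCB, polyC1).
by rewrite !exprS; ring.
Qed.

End Determinants.

Definition nat_fun m B (mu : {ffun 'I_m -> 'I_B}) (j : nat) : nat :=
  if insub j is Some j' then mu j' else 0%N.

Lemma nat_funE m B (mu : {ffun 'I_m -> 'I_B}) (j : 'I_m) : nat_fun mu j = mu j.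
Proof. by rewrite /nat_fun insubT //= => j_lt; congr (nat_of_ord (mu _)); apply: val_inj. Qed.

Lemma nat_fun_default m B (mu : {ffun 'I_m -> 'I_B}) j : (m <= j)%N -> nat_fun mu j = 0%N.
Proof. by move=> mj; rewrite /nat_fun insubF // ltnNge mj. Qed.

Section Multilinearity.
Variables (R : comNzRingType) (x : nat -> R).

(** Each column picks one of its summands; the bound [B] keeps the type of choices finite. *)
Lemma det_jt_multilinear m B (P : nat -> pred nat) (c : nat -> nat -> R)
    (e : nat -> nat -> {poly R}) :
  \det (jt_mx x m (fun j => \sum_(u < B | P j u) c j u *: e j u))
  = \sum_(mu : {ffun 'I_m -> 'I_B} | [forall j : 'I_m, P j (mu j)])
      (\prod_(j < m) c j (mu j)) * \det (jt_mx x m (fun j => e j (nat_fun mu j))).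
Proof.
rewrite -det_tr [LHS]/determinant.
under [RHS]eq_bigr => mu _ do rewrite -det_tr /determinant mulr_sumr.
rewrite [RHS]exchange_big /=; apply: eq_bigr => s _.
under eq_bigr => i _ do rewrite !mxE linear_sum coef_sum.
rewrite bigA_distr_big_dep /= mulr_sumr; apply: eq_big => [mu | mu _].
  by apply/familyP/forallP.
rewrite mulrCA; congr (_ * _); rewrite -big_split /=; apply: eq_bigr => i _.
by rewrite !mxE linearZ coefZ nat_funE.
Qed.
End Multilinearity.

Section Branching.
Variables (R : idomainType) (x t : nat -> R).

(* With [y = x_m], the column operation replacing the [j]-th column [F_j] by
   [(1 - t_j y) F_j - y ^ (lam_j - lam_(j+1) + 1) F_(j+1)] makes it divisible by
   ['X], and [strip_telescope] expands the quotient over the admissible [mu_j]. *)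
Lemma jt_det_branching m (lam : nat -> nat) B :
  (forall j, lam j.+1 <= lam j)%N -> (lam 0%N < B)%N ->
  (forall j, (j < m)%N -> 1 - t j * x m != 0) ->
  jt_det x t m.+1 lam =
  \sum_(mu : {ffun 'I_m -> 'I_B} | [forall j : 'I_m, lam j.+1 <= mu j <= lam j]%N)
    x m ^+ lam m * (\prod_(j < m) (x m ^+ (lam j - mu j) *
       (if (lam j.+1 < mu j)%N then 1 - t j * x m else 1))) *
    jt_det x t m (nat_fun mu).
Proof.
move=> lam_dec lam_B reg; set y := x m.
have lam_lt j : (lam j < B)%N.
  by elim: j => // j IHj; apply: leq_ltn_trans IHj.
have reg_prod : \prod_(j < m) (1 - t j * y) != 0.
  by apply/prodf_neq0 => j _; apply: reg.
(* The column operation scales the determinant by this product, and the last column evaluated at y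
   yields it again, so it can be cancelled. *)
apply: (mulfI reg_prod).
pose f j : {poly R} := 'X^(lam j + (m - j)) * tfactor t j.
pose e j : {poly R} := \sum_(u < B | (lam j.+1 <= u <= lam j)%N)
  (y ^+ (lam j - u) * (if (lam j.+1 < u)%N then 1 - t j * y else 1)) *:
    ('X^(u + (m - j.+1)) * tfactor t j).
have eE j : (j < m)%N -> ('X - y%:P) * e j =
    (1 - t j * y) *: f j - y ^+ (lam j - lam j.+1).+1 *: f j.+1.
  move=> jm; pose M := 'X^(m - j.+1) * tfactor t j.
  have -> : e j = (\sum_(lam j.+1 <= u < (lam j).+1)
      (y ^+ (lam j - u) * (if (lam j.+1 < u)%N then 1 - t j * y else 1)) *: 'X^u) * M.
    rewrite (big_nat_widenl _ 0) // (big_nat_widen _ _ B) ?big_mkord //.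
    rewrite mulr_suml; apply: eq_big => [u | u _]; first by rewrite ltnS andbC.
    by rewrite /M exprD -!mulrA -scalerAl.
  have := strip_telescope y (t j) (lam j.+1) (lam j - lam j.+1).
  rewrite subnKC // mulrA => ->; rewrite /f /tfactor big_ord_recr /= mulrBl -!scalerAl.
  congr (_ *: _ - _ *: _); rewrite /M mulrA.
    by rewrite -exprD; congr ('X^_ * _); lia.
  by rewrite exprD -/(tfactor t j); ring.
have eT j : (j < m)%N -> (1 - t j * y) *: resolv y (f j)
      + (- y ^+ (lam j - lam j.+1).+1) *: resolv y (f j.+1) = e j * 'X.
  (* With g = e_j X one has S g = e_j, so [eE] is the equation g = F + y S g that characterizes the
     resolvent of the combination F of the two columns. *)
  move=> jm; rewrite scaleNr -!linearZ -linearB /=; apply/esym/resolv_uniq.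
  have -> : drop_poly 1 (e j * 'X) = e j by rewrite -['X]expr1 drop_polyMXn_id.
  rewrite -eE //.
  by rewrite -mul_polyC; ring.
pose h j := if (j < m)%N then e j * 'X else resolv y (f j).
transitivity (\det (\matrix_(i < m.+1, j < m.+1) (resolvs x m (h j))`_(m - i))).
  rewrite (@det_colop _ _ (jt_mx x m.+1 f) (fun j => - y ^+ (lam j - lam j.+1).+1)
    (fun j => if (j < m)%N then 1 - t j * y else 1)).
  - rewrite /jt_det big_ord_recr /= ltnn mulr1; congr (_ * _).
    by apply: eq_bigr => j _; rewrite ltn_ord.
  - move=> i j k kj; have jm : (j < m)%N by rewrite -ltnS -kj.
    rewrite !mxE /h jm -eT // linearD !linearZ /= coefD !coefZ subSS kj //.
  move=> i j [jm]; have jnm : (j < m)%N = false by rewrite jm ltnn.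
  by rewrite !mxE /h jnm mul1r subSS.
rewrite (@det_jt_reduce _ _ _ _ e); last by move=> j jm; rewrite /h jm.
(* The constant coefficient of the last column is f_m evaluated at y, that is y^(lam_m) times the
   product to be cancelled. *)
rewrite /h ltnn resolv_coef0 /f subnn addn0 hornerM hornerXn.
have -> : (tfactor t m).[y] = \prod_(j < m) (1 - t j * y).
  by rewrite horner_prod; apply: eq_bigr => j _; rewrite !hornerE.
rewrite (@det_jt_multilinear _ _ m B (fun j u => lam j.+1 <= u <= lam j)%N
  (fun j u => y ^+ (lam j - u) * (if (lam j.+1 < u)%N then 1 - t j * y else 1))
  (fun j u => 'X^(u + (m - j.+1)) * tfactor t j)).
rewrite [y ^+ _ * _]mulrC -mulrA; congr (_ * _).
by rewrite mulr_sumr; apply: eq_bigr => mu _; rewrite mulrA.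
Qed.
End Branching.

(** * One row of the lattice *)

Lemma big_tuple_rcons (R : nmodType) (T : finType) k (F : k.+1.-tuple T -> R) :
  \sum_s F s = \sum_(s : k.-tuple T) \sum_(a : T) F [tuple of rcons s a].
Proof.
rewrite pair_big /= (reindex (fun p : k.-tuple T * T => [tuple of rcons p.1 p.2])) //.
apply/onW_bij/inj_card_bij; last by rewrite card_prod !card_tuple expnS mulnC.
move=> [s a] [s' a'] /(congr1 val) /= /rcons_inj [ss' ->].
by congr (_, _); apply: val_inj.
Qed.

Lemma big_tuple0 (R : nmodType) (T : finType) (F : 0.-tuple T -> R) :
  \sum_s F s = F [tuple].
Proof. by rewrite (big_pred1 [tuple]) // => s; rewrite (tuple0 s); apply/esym/eqP/val_inj. Qed.

Section Words.
Variables (V : Type) (g : nat -> V).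

Definition word L (s : nat -> bool) : seq V := [seq g c | c <- iota 0 L & s c].

Lemma wordS L s : word L.+1 s = word L s ++ (if s L then [:: g L] else [::]).
Proof.
by rewrite /word -addn1 iotaD filter_cat map_cat /= add0n; case: (s L).
Qed.

End Words.
Arguments word : simpl never.

Lemma eq_word (V : Type) (g g' : nat -> V) L (s s' : nat -> bool) :
  (forall c, (c < L)%N -> s c = s' c) ->
  (forall c, (c < L)%N -> s c -> g c = g' c) -> word g L s = word g' L s'.
Proof.
elim: L => // L IHL ss' gg'; rewrite !wordS IHL => [|c cL|c cL]; last 2 first.
- by apply: ss'; rewrite ltnW.
- by apply: gg'; rewrite ltnW.
by rewrite -ss' //; case: ifP => // sL; rewrite gg'.
Qed.

Section RowTransfer.
Variables (R : comNzRingType) (w : nat -> bool -> bool -> bool -> bool -> R).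

(* The horizontal labels are summed over, [right] being the last of them. *)
Fixpoint row_weight L (top bot : nat -> bool) (right : bool) : R :=
  if L is c.+1 then
    \sum_(left : bool)
      w c (top c) right (bot c) left * row_weight c top bot left
  else (~~ right)%:R.

Lemma eq_row_weight L top bot top' bot' right :
  (forall c, (c < L)%N -> top c = top' c) ->
  (forall c, (c < L)%N -> bot c = bot' c) ->
  row_weight L top bot right = row_weight L top' bot' right.
Proof.
elim: L right => //= L IHL right tt' bb'; apply: eq_bigr => left _.
rewrite tt' // bb' // IHL // => c cL; [apply: tt' | apply: bb']; exact: ltnW.
Qed.

Variables (V : lmodType R) (D : seq V -> R).
Hypothesis D_alternating : forall l1 l2 f, D (l1 ++ f :: f :: l2) = 0.

Variables (top : nat -> bool) (g : nat -> V).

(* The sum of [D] over the bottom labels of the first [L] columns, weighted by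
   these columns, as a function of the last horizontal label and of the letters
   [l] contributed by the remaining columns. *)
Fixpoint row_sum L (right : bool) (l : seq V) : R :=
  if L is c.+1 then
    \sum_(left : bool) \sum_(b : bool)
      w c (top c) right b left * row_sum c left (if b then g c :: l else l)
  else (~~ right)%:R * D l.

Lemma row_sumE L right l :
  row_sum L right l = \sum_(s : L.-tuple bool)
     row_weight L top (nth false s) right * D (word g L (nth false s) ++ l).
Proof.
elim: L right l => [|L IHL] right l; first by rewrite big_tuple0.
rewrite big_tuple_rcons exchange_big /=.
under [RHS]eq_bigr => b _ do under eq_bigr => s _ do rewrite mulr_suml.
under [RHS]eq_bigr => b _ do rewrite exchange_big.
rewrite [RHS]exchange_big /=; apply: eq_bigr => left _; apply: eq_bigr => b _.
rewrite IHL mulr_sumr; apply: eq_bigr => s _.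
have bL : nth false (rcons s b) L = b by rewrite nth_rcons size_tuple ltnn eqxx.
have sc c : (c < L)%N -> nth false (rcons s b) c = nth false s c.
  by move=> cL; rewrite nth_rcons size_tuple cL.
rewrite bL mulrA; congr (_ * _ * D _).
  by apply: eq_row_weight => // c cL; rewrite sc.
rewrite wordS bL -catA.
rewrite -(@eq_word _ g g L (nth false (rcons s b)) (nth false s)) //.
by case: (b).
Qed.

Lemma row_sum_alternating L right l1 l2 f : row_sum L right (l1 ++ f :: f :: l2) = 0.
Proof.
rewrite row_sumE big1 // => s _.
by rewrite catA D_alternating mulr0.
Qed.

End RowTransfer.

Section RectangularRow.
Variables (R : comNzRingType) (z : R) (V : lmodType R) (D : seq V -> R).
Hypothesis D_linear : forall l1 l2 a f g,
  D (l1 ++ (a *: f + g) :: l2) = a * D (l1 ++ f :: l2) + D (l1 ++ g :: l2).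
Hypothesis D_alternating : forall l1 l2 f, D (l1 ++ f :: f :: l2) = 0.

Fixpoint rect_step (g : nat -> V) c : V :=
  if c is c'.+1 then z *: rect_step g c' + g c else g 0%N.

(* If the line enters the column [L] from the left, the letter it carries is a sum
   over the columns since the previous particle; by alternation it can be
   completed to [rect_step g (L - 1)], as this adds a multiple of the letter before. *)
Lemma rect_row_sum top g L l :
  row_sum (fun=> rect_weight z) D top g L false l = D (word (rect_step g) L top ++ l)
  /\ row_sum (fun=> rect_weight z) D top g L true l =
     if L is c.+1 then D (word (rect_step g) L top ++ rect_step g c :: l) else 0.
Proof.
elim: L l => [|L IHL] l; first by rewrite /= mul1r mul0r.
have stepE : D (word (rect_step g) L top ++ rect_step g L :: l) =
    row_sum (fun=> rect_weight z) D top g L false (g L :: l)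
    + z * row_sum (fun=> rect_weight z) D top g L true l.
  rewrite (IHL (g L :: l)).1 (IHL l).2.
  by case: L {IHL} => [|L]; rewrite ?mulr0 ?addr0 //= D_linear addrC.
(* If the top label at [L] is 1, no line leaves to the right; on the other side the letter
   [rect_step g L] then occurs twice in a row. *)
rewrite /= !big_bool /= wordS; case: (top L); rewrite ?cats0 -?catA /= ?mul0r ?mul1r ?add0r ?addr0.
  by rewrite D_alternating stepE addrC.
by rewrite (IHL l).1 stepE addrC.
Qed.

Lemma rect_rowE top g L :
  \sum_(s : L.-tuple bool) row_weight (fun=> rect_weight z) L top (nth false s) false
     * D (word g L (nth false s)) = D (word (rect_step g) L top).
Proof.
rewrite -[word (rect_step g) L top]cats0 -(rect_row_sum top g L [::]).1 row_sumE.
by under [RHS]eq_bigr => s _ do rewrite cats0.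
Qed.

End RectangularRow.

(* Beyond the end of a jagged row the lattice is completed to a rectangle by
   vertices which a vertical line crosses straight and no horizontal line meets. *)
Definition frozen_weight (R : comNzRingType) (top right bottom left : bool) : R :=
  [&& top == bottom, ~~ right & ~~ left]%:R.

Definition jagged_row_weight (R : comNzRingType) (z : R) (len c : nat) :=
  if (c < len)%N then jagged_weight z else @frozen_weight R.

Section JaggedRow.
Variables (R : comNzRingType) (z : R) (len : nat) (V : lmodType R) (D : seq V -> R).
Hypothesis D_linear : forall l1 l2 a f g,
  D (l1 ++ (a *: f + g) :: l2) = a * D (l1 ++ f :: l2) + D (l1 ++ g :: l2).
Hypothesis D_alternating : forall l1 l2 f, D (l1 ++ f :: f :: l2) = 0.

Definition jagged_step (g : nat -> V) c : V :=
  if (c < len)%N then z *: g c.+1 + g c else g c.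

Let rsum top g := row_sum (jagged_row_weight z len) D top g.

(* A line leaving the column [L - 1] to the right must turn down in the column [L],
   where it picks up the letter [g L]. *)
Lemma jagged_row_sum top g L l : (L <= len)%N ->
  rsum top g L false l + rsum top g L true (g L :: l) = D (word (jagged_step g) L top ++ l).
Proof.
elim: L l => [|L IHL] l L_len; first by rewrite /rsum /= mul1r mul0r addr0.
have alt : rsum top g L true (g L :: g L :: l) = 0.
  exact: (row_sum_alternating _ D_alternating _ _ _ _ [::]).
rewrite {1 2}/rsum /= /jagged_row_weight L_len !big_bool wordS /=.
rewrite -/(jagged_row_weight z len) -!/(rsum top g L _ _).
case: (top L); rewrite ?cats0 -?catA /= !(mul0r, mul1r, add0r, addr0); last first.
  by rewrite addrC IHL // ltnW.
rewrite /jagged_step L_len -/(jagged_step g) D_linear -!IHL 1?ltnW //.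
by rewrite alt addr0 -mulrDr addrC; congr (_ * _ + _); rewrite addrC.
Qed.

Lemma jagged_row_sum_end (top : nat -> bool) g L l : (len < L)%N -> top len ->
  rsum top g L false l = D (word (jagged_step g) L top ++ l)
  /\ rsum top g L true l = 0.
Proof.
move=> + top_len; elim: L l => // L IHL l; rewrite ltnS leq_eqVlt.
rewrite /rsum /= /jagged_row_weight !big_bool wordS /=.
rewrite -/(jagged_row_weight z len) -!/(rsum top g L _ _).
case: ltngtP => //= [len_L _ | <- _].
  rewrite !(IHL _ len_L).1 !(IHL _ len_L).2 /frozen_weight /jagged_step.
  rewrite [(L < _)%N]ltnNge ltnW //=.
  by case: (top L); rewrite /= ?cats0 -?catA !(mulr0, mul0r, mul1r, add0r, addr0).
have alt : rsum top g len true (g len :: g len :: l) = 0.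
  exact: (row_sum_alternating _ D_alternating _ _ _ _ [::]).
rewrite top_len /frozen_weight /= !(mul0r, mul1r, add0r, addr0) -catA.
rewrite {2}/jagged_step ltnn /= -jagged_row_sum // alt addr0; split=> //.
Qed.

Lemma jagged_rowE (top : nat -> bool) g L : (len < L)%N -> top len ->
  \sum_(s : L.-tuple bool) row_weight (jagged_row_weight z len) L top (nth false s) false
     * D (word g L (nth false s)) = D (word (jagged_step g) L top).
Proof.
move=> lenL top_len.
rewrite -[word (jagged_step g) L top]cats0 -(jagged_row_sum_end _ _ lenL top_len).1 /rsum row_sumE.
by under [RHS]eq_bigr => s _ do rewrite cats0.
Qed.

End JaggedRow.

(** * The determinant of a word *)

Lemma nth_mktuple_lt (T : Type) (x0 : T) L (f : 'I_L -> T) k (kL : (k < L)%N) :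
  nth x0 (mktuple f) k = f (Ordinal kL).
Proof. by rewrite -(nth_mktuple f x0 (Ordinal kL)). Qed.

Section WordDet.
Variables (R : comNzRingType) (n : nat).
Implicit Types (l : seq {poly R}).

(** The alternating functional on words. An arbitrary row of labels may give a word whose length is
    not [n]; its value has to be 0. *)
Definition word_det l : R :=
  if size l == n then \det (\matrix_(i < n, j < n) (nth 0 l i)`_j) else 0.

Lemma word_det_linear l1 l2 a f g :
  word_det (l1 ++ (a *: f + g) :: l2)
    = a * word_det (l1 ++ f :: l2) + word_det (l1 ++ g :: l2).
Proof.
rewrite /word_det !size_cat /=; case: eqP => [szl|]; last by rewrite mulr0 addr0.
have l1n : (size l1 < n)%N by rewrite -szl addnS ltnS leq_addr.
pose i1 := Ordinal l1n.
rewrite -[X in _ = _ + X]mul1r; apply: (determinant_multilinear (i0 := i1)).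
- apply/rowP => j; rewrite !mxE /= !nth_cat ltnn subnn /= coefD coefZ mul1r //.
- apply/matrixP => i j; rewrite !mxE /= !nth_cat; case: ltngtP => // [/subnSK <-//|eq_i].
  by have /eqP[] := neq_lift i1 i; apply: val_inj.
apply/matrixP => i j; rewrite !mxE /= !nth_cat; case: ltngtP => // [/subnSK <-//|eq_i].
by have /eqP[] := neq_lift i1 i; apply: val_inj.
Qed.

Lemma word_det_alternating l1 l2 f : word_det (l1 ++ f :: f :: l2) = 0.
Proof.
rewrite /word_det !size_cat /=; case: eqP => [szl|//].
have l1n : (size l1 < n)%N by rewrite -szl addnS ltnS leq_addr.
have l1n' : ((size l1).+1 < n)%N by rewrite -szl !addnS !ltnS leq_addr.
apply: (determinant_alternate (i1 := Ordinal l1n) (i2 := Ordinal l1n')).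
  by rewrite -(inj_eq val_inj) /= neq_ltn ltnSn.
by move=> j; rewrite !mxE !nth_cat /= ltnn ltnNge leqnSn subnn subSnn.
Qed.

(** The bottom boundary as a determinant: a word of [n] distinct powers of X that misses some X^k
    with k < n gives a zero column, and otherwise the matrix is the identity. *)
Lemma word_det_Xn L (s : L.-tuple bool) : (n <= L)%N ->
  word_det (word (fun c => 'X^c) L (nth false s)) = (s == [tuple (val c < n)%N | c < L])%:R.
Proof.
move=> nL; case: eqP => [->|s_init] /=.
  have -> : word (fun c => 'X^c) L (nth false [tuple (val c < n)%N | c < L])
      = [seq 'X^c | c <- iota 0 n] :> seq {poly R}.
    have iotaL : iota 0 L = iota 0 n ++ iota n (L - n) by rewrite -iotaD subnKC.
    congr map; rewrite iotaL filter_cat.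
    rewrite (eq_in_filter (a2 := xpredT)) ?filter_predT; last first.
      move=> c; rewrite mem_iota /= add0n => cn.
      by rewrite (nth_mktuple_lt _ _ (leq_trans cn nL)).
    rewrite (eq_in_filter (a2 := pred0)) ?filter_pred0 ?cats0 //.
    move=> c; rewrite mem_iota subnKC // => /andP [nc cL].
    by rewrite (nth_mktuple_lt _ _ cL) /= ltnNge nc.
  rewrite /word_det size_map size_iota eqxx.
  rewrite -[RHS](det1 R n); congr (\det _); apply/matrixP => i j.
  rewrite !mxE (nth_map 0%N) ?size_iota // nth_iota // add0n coefXn.
  by rewrite eq_sym -(inj_eq val_inj).
rewrite /word_det; case: eqP => // sz_w.
set w := [seq c <- iota 0 L | nth false s c].
have [/allP n_w | ] := boolP (all (mem w) (iota 0 n)).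
  case: s_init; apply: eq_from_tnth => c; rewrite tnth_mktuple (tnth_nth false).
  have eq_w : iota 0 n =i w.
    apply: (uniq_min_size (iota_uniq 0 n) n_w _).2.
    by rewrite size_iota -sz_w size_map.
  have := eq_w (val c); rewrite mem_iota mem_filter mem_iota /= !add0n ltn_ord andbT.
  by move=> ->.
rewrite -has_predC => /hasP [k]; rewrite mem_iota add0n => /= kn k_w.
rewrite (expand_det_col _ (Ordinal kn)) big1 // => i _; rewrite mxE.
have i_w : (i < size w)%N by move: sz_w; rewrite size_map -/w => ->.
rewrite /word -/w (nth_map 0%N) // coefXn /=.
by case: eqP => [ki|_]; [rewrite ki mem_nth // in k_w | rewrite mul0r].
Qed.

(** A word lists columns from left to right, whereas the parts are listed from the rightmost
    particle on. Up to transposition the rows and the columns are both reversed, so the two signs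
    cancel. *)
Lemma word_det_rev (f : nat -> {poly R}) :
  word_det (rev [seq f k | k <- iota 0 n])
    = \det (\matrix_(i < n, j < n) (f j)`_(n - i.+1)).
Proof.
rewrite /word_det size_rev size_map size_iota eqxx -det_tr.
set A := (X in _ = \det X); pose s := perm (@rev_ord_inj n).
have -> : (\matrix_(i < n, j < n) (nth 0 (rev [seq f k | k <- iota 0 n]) i)`_j)^T
    = row_perm s (col_perm s A).
  apply/matrixP => i j; rewrite !mxE !permE /=.
  rewrite nth_rev ?size_map ?size_iota // (nth_map 0%N) ?size_iota ?rev_ord_proof //.
  rewrite nth_iota ?rev_ord_proof // add0n; congr (_`__).
  by have := ltn_ord i; lia.
rewrite row_permE col_permE !det_mulmx !det_perm odd_permV mulrCA -expr2 sqrr_sign mulr1 //.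
Qed.

End WordDet.

(** * The completed lattice *)

(** The operator of the new row is innermost in [resolvs], so applying [resolvs x r] to [resolvXS]
    gives the recursion that defines [rect_step]. *)
Lemma rect_step_resolvs (R : comNzRingType) (x : nat -> R) r c :
  rect_step (x r) (fun c => resolvs x r 'X^c) c = resolvs x r.+1 'X^c.
Proof.
elim: c => [|c IHc] /=; first by rewrite resolv1.
by rewrite IHc /= resolvXS linearD linearZ addrC.
Qed.

(** This restricts the induction in [lattice_sum_jagged] to the bottom rows that satisfy its
    hypothesis. *)
Lemma row_weight_frozen (R : comNzRingType) (z : R) len L top bot right c :
  (len <= c < L)%N -> top c != bot c ->
  row_weight (jagged_row_weight z len) L top bot right = 0.
Proof.
move=> /andP [len_c]; elim: L right => // L IHL right; rewrite ltnS leq_eqVlt.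
move=> /predU1P [<-|cL] ne_c /=; apply: big1 => left _; last by rewrite IHL ?mulr0.
by rewrite /jagged_row_weight ltnNge len_c /= /frozen_weight (negPf ne_c) mul0r.
Qed.

Section Lattice.
Variables (R : comNzRingType) (x t : nat -> R) (n : nat) (lam : nat -> nat) (L : nat).
Hypothesis lam_dec : forall i j, (i <= j)%N -> (lam j <= lam i)%N.
Hypothesis lam_L : (lam 0%N + n)%N = L.

(** This is both the length of the jagged row [k] and the column of the [k]-th particle at the top,
    so the first frozen column of each jagged row carries a particle. *)
Definition jagged_length k := (lam k + n - k.+1)%N.

Definition lattice_weight r : nat -> bool -> bool -> bool -> bool -> R :=
  if (r < n)%N then fun=> rect_weight (x r)
  else jagged_row_weight (- t (r - n)) (jagged_length (r - n)).

Fixpoint lattice_sum r (top : L.-tuple bool) : R :=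
  if r is r'.+1 then
    \sum_(bot : L.-tuple bool)
      row_weight (lattice_weight r') L (nth false top) (nth false bot) false
        * lattice_sum r' bot
  else (top == [tuple (val c < n)%N | c < L])%:R.

Lemma lattice_sum_rect r top : (r <= n)%N ->
  lattice_sum r top =
    word_det n (word (fun c => resolvs x r 'X^c) L (nth false top)).
Proof.
elim: r top => [|r IHr] top rn /=.
  by rewrite word_det_Xn // -lam_L leq_addl.
under eq_bigr => bot _ do rewrite IHr 1?ltnW // /lattice_weight rn.
rewrite (rect_rowE _ (@word_det_linear _ n) (@word_det_alternating _ n)).
by congr word_det; apply: eq_word => // c _ _; exact: rect_step_resolvs.
Qed.

(** A particle in column [c] gains the factor of the jagged row [k] only if this row contains [c];
    otherwise the column is frozen there. *)
Definition column_factor i c : {poly R} :=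
  \prod_(k < i | (c < jagged_length k)%N) (1 - t k *: 'X).

Lemma jagged_length_lt i k : (k < i < n)%N -> (jagged_length i < jagged_length k)%N.
Proof.
by move=> /andP [ki i_n]; have := lam_dec (ltnW ki); rewrite /jagged_length; lia.
Qed.

Lemma jagged_length_ltL k : (k < n)%N -> (jagged_length k < L)%N.
Proof. by move=> kn; have := lam_dec (leq0n k); rewrite /jagged_length -lam_L; lia. Qed.

Lemma column_factorT i c : (i < n)%N -> (c <= jagged_length i)%N ->
  column_factor i c = tfactor t i.
Proof.
move=> i_n c_le; apply: eq_bigl => k.
by rewrite (leq_ltn_trans c_le) // jagged_length_lt // ltn_ord.
Qed.

Lemma column_factorS i c : column_factor i.+1 c =
  column_factor i c * (if (c < jagged_length i)%N then 1 - t i *: 'X else 1).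
Proof. by rewrite /column_factor big_mkcond big_ord_recr -big_mkcond. Qed.

(** The hypothesis on [top] supplies the particle in the first frozen column that [jagged_rowE]
    requires. Frozen columns hand such particles on to every lower row of nonzero weight, so the
    induction goes through. *)
Lemma lattice_sum_jagged i (top : L.-tuple bool) : (i <= n.-1)%N ->
  (forall k, (k < i)%N -> nth false top (jagged_length k)) ->
  lattice_sum (n + i) top = word_det n
    (word (fun c => resolvs x n ('X^c * column_factor i c)) L (nth false top)).
Proof.
elim: i top => [|i IHi] top i_n top_len.
  rewrite addn0 lattice_sum_rect //; congr word_det; apply: eq_word => // c _ _.
  by rewrite /column_factor big_ord0 mulr1.
have i_lt : (i < n)%N by lia.
pose g c : {poly R} := resolvs x n ('X^c * column_factor i c).
transitivity (word_det n
  (word (jagged_step (- t i) (jagged_length i) g) L (nth false top))).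
  rewrite -(jagged_rowE _ (@word_det_linear _ n) (@word_det_alternating _ n) _
    (jagged_length_ltL i_lt) (top_len i (ltnSn i))).
  rewrite addnS /=; apply: eq_bigr => bot _.
  rewrite /lattice_weight ltnNge leq_addr /= addKn.
  have [/forallP bot_len | /forallPn [k bot_k]] :=
      boolP [forall k : 'I_i, nth false bot (jagged_length k)].
    congr (_ * _); apply: IHi; first exact: ltnW.
    by move=> k ki; exact: (bot_len (Ordinal ki)).
  have kn : (k < n)%N by apply: ltn_trans i_lt; exact: ltn_ord.
  rewrite (@row_weight_frozen _ _ _ _ _ _ _ (jagged_length k)) ?mul0r //.
    by rewrite jagged_length_ltL // ltnW // jagged_length_lt // ltn_ord.
  by rewrite top_len ?(negPf bot_k) // ltnW // ltnS ltn_ord.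
congr word_det; apply: eq_word => // c _ _; rewrite /jagged_step /g column_factorS.
case: ifP => c_len; last by rewrite mulr1.
(* Both c and c + 1 are at most [jagged_length i], so their column factors agree and g_c - t_i
   g_(c+1) acquires the factor 1 - t_i X. *)
rewrite !column_factorT // 1?ltnW // -linearP /=; congr (resolvs _ _ _).
by rewrite scaleNr -mul_polyC -[t i *: 'X]mul_polyC exprS; ring.
Qed.

Lemma lattice_sum_top (top : L.-tuple bool) :
  (forall c, (c < L)%N -> nth false top c = [exists k : 'I_n, c == jagged_length k]) ->
  lattice_sum (n + n.-1) top = jt_det x t n lam.
Proof.
move=> topE.
have top_len k : (k < n)%N -> nth false top (jagged_length k).
  move=> kn; rewrite topE ?jagged_length_ltL //.
  by apply/existsP; exists (Ordinal kn).
rewrite lattice_sum_jagged // => [|k kn]; last by apply: top_len; lia.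
rewrite /jt_det /jt_mx.
pose f k : {poly R} := resolvs x n ('X^(lam k + (n - k.+1)) * tfactor t k).
rewrite -[RHS](word_det_rev n f); congr word_det.
have -> : [seq f k | k <- iota 0 n] =
    [seq resolvs x n ('X^c * column_factor n.-1 c) | c <- [seq jagged_length k | k <- iota 0 n]].
  rewrite -map_comp; apply/eq_in_map => k; rewrite mem_iota /= add0n => kn.
  congr (resolvs _ _ ('X^_ * _)); first by rewrite /jagged_length; lia.
  (* The lengths decrease strictly, so exactly the jagged rows j < k contain the column
     [jagged_length k]. *)
  rewrite /tfactor /column_factor.
  rewrite (big_ord_widen_cond n.-1 xpredT (fun k => 1 - t k *: 'X)); last by lia.
  apply: eq_bigl => j /=; have := ltn_ord j; rewrite ltn_predRL => jn.
  case: (ltngtP j k) => [jk | kj | ->]; last by rewrite ltnn.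
    by rewrite jagged_length_lt // jk.
  by rewrite ltnNge ltnW // jagged_length_lt // kj ltnW.
rewrite -map_rev; congr map.
apply: (irr_sorted_eq ltn_trans ltnn).
- by apply: sorted_filter (iota_ltn_sorted 0 L); exact: ltn_trans.
- rewrite rev_sorted; apply/(sortedP 0%N) => i; rewrite size_map size_iota => i_n.
  have i_n' := ltnW i_n; rewrite !(nth_map 0%N) ?size_iota // !nth_iota //.
  by rewrite jagged_length_lt // !add0n i_n ltnSn.
move=> c; rewrite mem_filter mem_rev mem_iota add0n /=.
apply/idP/mapP => [/andP [+ cL] | [k]].
  by rewrite topE // => /existsP [k /eqP ->]; exists (val k); rewrite ?mem_iota ?ltn_ord.
by rewrite mem_iota add0n /= => kn ->; rewrite top_len // jagged_length_ltL.
Qed.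

End Lattice.

(** * Labelings of the completed rectangle *)

Lemma row_weightE (R : comNzRingType) (w : nat -> bool -> bool -> bool -> bool -> R)
    L top bot right :
  row_weight w L top bot right =
  \sum_(h : L.+1.-tuple bool | ~~ nth false h 0 && (nth false h L == right))
    \prod_(c < L) w c (top c) (nth false h c.+1) (bot c) (nth false h c).
Proof.
elim: L right => [|L IHL] right /=.
  rewrite big_mkcond big_tuple_rcons big_tuple0 big_bool /= !big_ord0.
  by case: right; rewrite ?addr0 ?add0r.
rewrite [RHS]big_mkcond big_tuple_rcons /=.
under eq_bigr => left _ do rewrite IHL mulr_sumr big_mkcond.
rewrite exchange_big /=; apply: eq_bigr => h _.
have hE c b : (c < L.+1)%N -> nth false (rcons h b) c = nth false h c.
  by move=> cL; rewrite nth_rcons size_tuple cL.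
have hL b : nth false (rcons h b) L.+1 = b by rewrite nth_rcons size_tuple ltnn eqxx.
rewrite [RHS](bigD1 right) //= [X in _ = _ + X]big1 ?addr0; last first.
  by move=> b /negPf b_right; rewrite hL b_right andbF.
rewrite [LHS](bigD1 (nth false h L)) //= [X in _ + X = _]big1 ?addr0; last first.
  by move=> b /negPf b_h; rewrite eq_sym b_h andbF.
rewrite hL !hE // !eqxx !andbT; case: ifP => // _.
rewrite big_ord_recr /= hL hE // mulrC; congr (_ * _).
by apply: eq_bigr => c _; rewrite !hE // ltnS // ltnW.
Qed.

Definition cell L (A : seq (L.-tuple bool)) r c : bool :=
  nth false (nth [::] [seq tval u | u <- A] r) c.

Lemma cell_rcons L (A : seq (L.-tuple bool)) u r c :
  cell (rcons A u) r c = if (r < size A)%N then cell A r c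
    else if r == size A then nth false u c else false.
Proof.
rewrite /cell map_rcons nth_rcons size_map; case: ifP => // _.
by case: ifP => // _; rewrite nth_nil.
Qed.

Lemma cell_mktuple K L (F : nat -> nat -> bool) r c : (r < K)%N -> (c < L)%N ->
  cell [tuple [tuple F (val r) (val c) | c < L] | r < K] r c = F r c.
Proof.
move=> rK cL; rewrite /cell (nth_map [tuple false | _ < L]) ?size_tuple //.
by rewrite (nth_mktuple_lt _ _ rK) (nth_mktuple_lt _ _ cL).
Qed.

Lemma eq_cell K L (A B : K.-tuple (L.-tuple bool)) :
  (forall r c, (r < K)%N -> (c < L)%N -> cell A r c = cell B r c) -> A = B.
Proof.
move=> AB; apply: eq_from_tnth => r; apply: eq_from_tnth => c.
have := AB r c (ltn_ord r) (ltn_ord c).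
rewrite /cell !(nth_map [tuple false | _ < L]) ?size_tuple //.
by rewrite -!tnth_nth.
Qed.

Section LatticeSum.
Variables (R : comNzRingType) (x t : nat -> R) (n : nat) (lam : nat -> nat) (L : nat).
Let w := lattice_weight x t n lam.

Definition lattice_boundary r (top : L.-tuple bool)
    (H : seq (L.+1.-tuple bool)) (V : seq (L.-tuple bool)) :=
  [&& nth top V 0 == [tuple (val c < n)%N | c < L], nth top V r == top
    & all (fun h : L.+1.-tuple bool => ~~ nth false h 0 && (nth false h L == false)) H].

Lemma lattice_sumE r top :
  lattice_sum x t n lam r top =
  \sum_(H : r.-tuple (L.+1.-tuple bool)) \sum_(V : r.+1.-tuple (L.-tuple bool)
      | lattice_boundary r top H V)
    \prod_(k < r) \prod_(c < L)
       w k c (cell V k.+1 c) (cell H k c.+1) (cell V k c) (cell H k c).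
Proof.
elim: r top => [|r IHr] top.
  rewrite big_tuple0 big_mkcond big_tuple_rcons big_tuple0 /=.
  rewrite (bigD1 top) //= [X in _ + X]big1 ?addr0 => [|v v_top].
    by rewrite big_ord0 /lattice_boundary /= eqxx andbT; case: eqP.
  by rewrite /lattice_boundary /= (negPf v_top) andbF.
rewrite /= big_tuple_rcons.
transitivity (\sum_(H : r.-tuple (L.+1.-tuple bool)) \sum_(h : L.+1.-tuple bool)
    \sum_(V : r.+1.-tuple (L.-tuple bool)) \sum_(bot : L.-tuple bool)
    if [&& ~~ nth false h 0, nth false h L == false & lattice_boundary r bot H V]
    then (\prod_(c < L)
       w r c (nth false top c) (nth false h c.+1) (nth false bot c) (nth false h c))
      * \prod_(k < r) \prod_(c < L)
       w k c (cell V k.+1 c) (cell H k c.+1) (cell V k c) (cell H k c)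
    else 0).
  under eq_bigr => bot _ do rewrite row_weightE IHr mulr_sumr.
  rewrite exchange_big; apply: eq_bigr => H _ /=.
  under eq_bigr => bot _ do rewrite mulr_suml big_mkcond /=.
  rewrite exchange_big; apply: eq_bigr => h _ /=.
  rewrite [RHS]exchange_big; apply: eq_bigr => bot _ /=.
  case: (boolP (~~ nth false h 0 && (nth false h L == false))) => [/andP [-> ->]|].
    by rewrite mulr_sumr big_mkcond.
  by move=> /negPf hc; rewrite big1 // => V _; rewrite andbA hc.
apply: eq_bigr => H _; apply: eq_bigr => h _.
rewrite [RHS]big_mkcond [RHS]big_tuple_rcons; apply: eq_bigr => V _.
have VE v k : (k <= r)%N -> nth top (rcons V v) k = nth top V k.
  by move=> kr; rewrite nth_rcons size_tuple ltnS kr.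
have Vd v k : (k <= r)%N -> nth v V k = nth top V k.
  by move=> kr; apply: set_nth_default; rewrite size_tuple.
have Vr v : nth top (rcons V v) r.+1 = v by rewrite nth_rcons size_tuple ltnn eqxx.
(* On the left only the [bot] equal to the last row of [V] contributes, and on the right only the
   new vertical row equal to [top]. *)
rewrite (bigD1 (nth top V r)) //= [X in _ + X = _]big1 ?addr0 => [|bot bot_V]; last first.
  rewrite /lattice_boundary (Vd bot r) //.
  by rewrite (eq_sym _ bot) (negPf bot_V) !andbF.
rewrite [RHS](bigD1 top) //= [X in _ = _ + X]big1 ?addr0 => [|v v_top]; last first.
  by rewrite /lattice_boundary Vr (negPf v_top) !andbF.
rewrite /lattice_boundary VE // Vr !eqxx !(Vd (nth top V r)) // eqxx /=.
rewrite all_rcons -!andbA.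
rewrite [in LHS](andbCA (nth false h L == false)) [in LHS]andbCA; case: ifP => // _.
rewrite [RHS]big_ord_recr [RHS]mulrC /=; congr (_ * _); last first.
  apply: eq_bigr => k _; apply: eq_bigr => c _; rewrite !cell_rcons !size_tuple /=.
  by rewrite !ltnS ltn_ord (ltnW (ltn_ord k)).
apply: eq_bigr => c _; rewrite !cell_rcons !size_tuple ltnSn ltnn !eqxx ltnn.
by rewrite /cell (nth_map top) ?size_tuple.
Qed.
End LatticeSum.

(** * The partition function *)

Lemma part_dec n (lam : n.-tuple nat) i j :
  is_partition lam -> (i <= j)%N -> (part lam j <= part lam i)%N.
Proof.
move=> lam_part ij; have [jn | nj] := ltnP j n; last first.
  by rewrite /part [nth _ _ j]nth_default ?size_tuple.
have geq_trans : transitive geq by move=> a b c /= ba cb; exact: leq_trans cb ba.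
apply: (sorted_leq_nth geq_trans leqnn 0%N lam_part) => //; rewrite inE size_tuple //.
exact: leq_ltn_trans jn.
Qed.

Lemma prod_seq_eq0 (R : comNzRingType) (I : eqType) (r : seq I) (F : I -> R) i :
  i \in r -> F i = 0 -> \prod_(j <- r) F j = 0.
Proof. by move=> /(big_rem i) -> -> /=; rewrite mul0r. Qed.

Lemma prod_iota (R : comNzRingType) k (F : nat -> R) :
  \prod_(i <- iota 0 k) F i = \prod_(i < k) F i.
Proof. by rewrite -(big_mkord xpredT) /index_iota subn0. Qed.

Section PartitionFunction.
Variables (n : nat) (lam : n.-tuple nat).
Hypothesis lam_part : is_partition lam.

Let K := (n + n.-1)%N.
Let L := (part lam 0 + n)%N.

Lemma mem_vertices r c :
  ((r, c) \in vertices lam) = (r < K)%N && (c < row_length lam r)%N.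
Proof.
apply/allpairsPdep/andP => [[r' [c' [+ + [-> ->]]]] | [rK cl]].
  by rewrite !mem_iota.
by exists r, c; rewrite !mem_iota.
Qed.

Lemma mem_hedges r c : ((r, c) \in hedges lam) =
  ((r, c) \in vertices lam) || (0 < c)%N && ((r, c.-1) \in vertices lam).
Proof.
rewrite mem_cat; congr (_ || _); apply/mapP/andP => [[[r' c'] v [-> ->]] // | [c0 v]].
by exists (r, c.-1); rewrite ?prednK.
Qed.

Lemma mem_vedges r c : ((r, c) \in vedges lam) =
  ((r, c) \in vertices lam) || (0 < r)%N && ((r.-1, c) \in vertices lam).
Proof.
rewrite mem_cat; congr (_ || _); apply/mapP/andP => [[[r' c'] v [-> ->]] // | [r0 v]].
by exists (r.-1, c); rewrite ?prednK.
Qed.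

Lemma row_length_dec r : (r.+1 < K)%N -> (row_length lam r.+1 <= row_length lam r)%N.
Proof.
rewrite /row_length => _; have := part_dec lam_part (leqnSn (r - n)).
have := part_dec lam_part (leq0n (r.+1 - n)).
case: (ltnP r n) => [rn | nr]; first by case: ltnP; lia.
by rewrite ltnNge (leqW nr) /= subSn //; lia.
Qed.

Lemma row_length_leL r : (r < K)%N -> (row_length lam r <= L)%N.
Proof.
rewrite /row_length /K /L => rK; have := part_dec lam_part (leq0n (r - n)).
by case: ltnP; lia.
Qed.

Lemma vertices_ltL r c : (r, c) \in vertices lam -> (c < L)%N.
Proof. by rewrite mem_vertices => /andP [rK /leq_trans -> //]; exact: row_length_leL. Qed.

Definition top_col c := [exists i : 'I_n, c == (part lam i + n - i.+1)%N].

Definition tuples_of (s : labeling lam) :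
    K.-tuple (L.+1.-tuple bool) * K.+1.-tuple (L.-tuple bool) :=
  ([tuple [tuple edge_label s.1 (val r, val c) | c < L.+1] | r < K],
   [tuple [tuple if (val r, val c) \in vedges lam then edge_label s.2 (val r, val c)
                 else top_col c | c < L] | r < K.+1]).

Definition labeling_of (E : K.-tuple (L.+1.-tuple bool) * K.+1.-tuple (L.-tuple bool)) :
    labeling lam :=
  ([ffun e => cell E.1 (val e).1 (val e).2], [ffun e => cell E.2 (val e).1 (val e).2]).

Lemma edge_label_ffun (Es : seq (nat * nat)) (F : nat -> nat -> bool) r c :
  edge_label [ffun e : seq_sub Es => F (val e).1 (val e).2] (r, c)
    = ((r, c) \in Es) && F r c.
Proof.
by rewrite /edge_label; case: insubP => [e -> /= e_rc | /negPf -> //]; rewrite ffunE e_rc.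
Qed.

Lemma edge_label_val (Es : seq (nat * nat)) (f : {ffun seq_sub Es -> bool}) e :
  edge_label f (val e) = f e.
Proof. by rewrite /edge_label valK. Qed.

Lemma hedges_lt r c : (r, c) \in hedges lam -> (r < K)%N && (c < L.+1)%N.
Proof.
rewrite mem_hedges => /orP [v | /andP [c0 v]].
  by have := vertices_ltL v; move: v; rewrite mem_vertices => /andP [-> _] /ltnW.
by have := vertices_ltL v; move: v; rewrite mem_vertices => /andP [-> _]; lia.
Qed.

Lemma vedges_lt r c : (r, c) \in vedges lam -> (r < K.+1)%N && (c < L)%N.
Proof.
rewrite mem_vedges => /orP [v | /andP [c0 v]]; rewrite (vertices_ltL v) andbT;
  by move: v; rewrite mem_vertices => /andP [+ _]; lia.
Qed.

Lemma tuples_ofK : cancel tuples_of labeling_of.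
Proof.
move=> [h v]; rewrite /labeling_of /tuples_of /=; congr (_, _); apply/ffunP => -[[r c] e];
  rewrite ffunE /=.
  have /andP [rK cL] := hedges_lt e.
  by rewrite (@cell_mktuple K L.+1 (fun r c => edge_label h (r, c))) // -edge_label_val.
have /andP [rK cL] := vedges_lt e.
rewrite (@cell_mktuple K.+1 L (fun r c =>
  if (r, c) \in vedges lam then edge_label v (r, c) else top_col c)) // e.
by rewrite -edge_label_val.
Qed.


Implicit Types E : K.-tuple (L.+1.-tuple bool) * K.+1.-tuple (L.-tuple bool).

(* [E] extends a boundary-compatible labeling of the jagged lattice by zero on the
   missing horizontal edges, and on the missing vertical ones by the labels
   prescribed at the top of their columns. *)
Record extended_state E : Prop := {
  ext_h : forall r c, (r < K)%N -> (c < L.+1)%N ->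
    (r, c) \notin vertices lam -> cell E.1 r c = false;
  ext_v : forall r c, (r < K.+1)%N -> (c < L)%N ->
    (r, c) \notin vertices lam -> cell E.2 r c = top_col c;
  ext_left : forall r, (r < K)%N -> cell E.1 r 0 = false;
  ext_bottom : forall c, (c < L)%N -> cell E.2 0 c = (c < n)%N
}.

Lemma labeling_ofE E r c : (r, c) \in vertices lam ->
  [/\ top_label (labeling_of E) (r, c) = cell E.2 r.+1 c,
      right_label (labeling_of E) (r, c) = cell E.1 r c.+1,
      bottom_label (labeling_of E) (r, c) = cell E.2 r c
    & left_label (labeling_of E) (r, c) = cell E.1 r c].
Proof.
move=> v; rewrite /top_label /right_label /bottom_label /left_label.
by split; rewrite /= edge_label_ffun ?mem_hedges ?mem_vedges /= v ?orbT.
Qed.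

Lemma K_gt0 : (0 < K)%N -> (0 < n)%N.
Proof. by rewrite /K; lia. Qed.

Lemma bottom_vertices c : (c < L)%N -> (0 < K)%N -> (0, c)%N \in vertices lam.
Proof.
by move=> cL K0; rewrite mem_vertices K0 /row_length (K_gt0 K0).
Qed.

Lemma L_eq0 : K = 0%N -> L = 0%N.
Proof.
rewrite /K /L => K0; have n0 : n = 0%N by lia.
by rewrite /part nth_default ?size_tuple n0.
Qed.

(** The boolean condition is the one produced by reindexing the partition function along
    [labeling_of]; its second half fixes the labels on the edges outside the jagged lattice. *)
Lemma extended_stateP E :
  reflect (extended_state E)
    (boundary_ok (labeling_of E) && (tuples_of (labeling_of E) == E)).
Proof.
apply: (iffP andP) => [[/allP bdr /eqP EE] | [eh ev el eb]].
  have E1 r c : (r < K)%N -> (c < L.+1)%N -> cell E.1 r c -> (r, c) \in hedges lam.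
    move=> rK cL; rewrite -{1}EE /= (@cell_mktuple K L.+1 (fun r c =>
      edge_label (labeling_of E).1 (r, c))) //.
    by rewrite edge_label_ffun => /andP [].
  have E2 r c : (r < K.+1)%N -> (c < L)%N -> (r, c) \notin vedges lam ->
      cell E.2 r c = top_col c.
    move=> rK cL /negPf v; rewrite -{1}EE /= (@cell_mktuple K.+1 L (fun r c =>
      if (r, c) \in vedges lam then edge_label (labeling_of E).2 (r, c) else top_col c)) //.
    by rewrite v.
  split.
  - move=> r c rK cL v; apply/negbTE/negP => Erc; have := E1 _ _ rK cL Erc.
    rewrite mem_hedges (negPf v) /= => /andP [c0 v'].
    have := bdr _ v'; have [-> -> -> ->] := labeling_ofE E v'.
    by rewrite /= prednK // v Erc /= andbF.
  - move=> r c rK cL v; have [e | /E2 ->//] := boolP ((r, c) \in vedges lam).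
    move: e; rewrite mem_vedges (negPf v) /= => /andP [r0 v'].
    have := bdr _ v'; have [-> -> -> ->] := labeling_ofE E v'.
    by rewrite /= prednK // v /= => /and4P [_ _ _ /eqP].
  - move=> r rK; apply/negbTE/negP => Erc; have := E1 _ _ rK (ltn0Sn L) Erc.
    rewrite mem_hedges /= orbF => v'.
    have := bdr _ v'; have [-> -> -> ->] := labeling_ofE E v'.
    by rewrite /= Erc.
  move=> c cL; have [K0|] := posnP K; first by exfalso; move: cL; rewrite (L_eq0 K0).
  move=> /(bottom_vertices cL) v; have := bdr _ v.
  by have [-> -> -> ->] := labeling_ofE E v => /= /and4P [_ _ /eqP].
split.
  apply/allP => -[r c] v; have [-> -> -> ->] := labeling_ofE E v => /=.
  have cL := vertices_ltL v; have rK : (r < K)%N.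
    by move: v; rewrite mem_vertices => /andP [].
  apply/and4P; split; apply/implyP; [move=> /eqP c0 | move=> v' | move=> /eqP r0 | move=> v'].
  - by rewrite c0 el.
  - by rewrite eh.
  - by rewrite r0 eb.
  by rewrite ev.
apply/eqP; rewrite [RHS]surjective_pairing; congr (_, _); apply: eq_cell => r c rK cL.
  rewrite (@cell_mktuple K L.+1 (fun r c => edge_label (labeling_of E).1 (r, c))) //.
  rewrite edge_label_ffun; case: (boolP ((r, c) \in hedges lam)) => //= e.
  by rewrite eh //; apply: contra e; rewrite mem_hedges => ->.
rewrite (@cell_mktuple K.+1 L (fun r c =>
  if (r, c) \in vedges lam then edge_label (labeling_of E).2 (r, c) else top_col c)) //.
rewrite edge_label_ffun; case: (boolP ((r, c) \in vedges lam)) => //= e.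
by rewrite ev //; apply: contra e; rewrite mem_vedges => ->.
Qed.


Definition top_row : L.-tuple bool := [tuple top_col (val c) | c < L].

Lemma lattice_boundaryP E :
  reflect [/\ forall c, (c < L)%N -> cell E.2 0 c = (c < n)%N,
              forall c, (c < L)%N -> cell E.2 K c = top_col c
            & forall r, (r < K)%N -> cell E.1 r 0 = false /\ cell E.1 r L = false]
    (lattice_boundary n K top_row E.1 E.2).
Proof.
have cellE r c : (r < K.+1)%N -> cell E.2 r c = nth false (nth top_row E.2 r) c.
  by move=> rK; rewrite /cell (nth_map top_row) ?size_tuple.
apply: (iffP and3P) => [[/eqP bot /eqP top /allP lr] | [bot top lr]].
  split=> [c cL | c cL | r rK].
  - by rewrite cellE // bot (nth_mktuple_lt _ _ cL).
  - by rewrite cellE // top (nth_mktuple_lt _ _ cL).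
  have [|/negPf h0 /eqP hL] := andP (lr (nth [tuple false | _ < L.+1] E.1 r) _).
    by rewrite mem_nth ?size_tuple.
  by rewrite /cell (nth_map [tuple false | _ < L.+1]) ?size_tuple.
split.
- apply/eqP/eq_from_tnth => c; rewrite tnth_mktuple (tnth_nth false).
  by rewrite -cellE // bot.
- apply/eqP/eq_from_tnth => c; rewrite tnth_mktuple (tnth_nth false).
  by rewrite -cellE // top.
apply/(all_nthP [tuple false | _ < L.+1]) => r; rewrite size_tuple => rK.
by have := lr r rK; rewrite /cell (nth_map [tuple false | _ < L.+1]) ?size_tuple // => -[-> ->].
Qed.

Lemma extended_state_boundary E : extended_state E -> lattice_boundary n K top_row E.1 E.2.
Proof.
move=> [eh ev el eb]; apply/lattice_boundaryP; split=> // [c cL | r rK].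
  by rewrite ev // mem_vertices ltnn.
rewrite el // eh // mem_vertices rK ltnNge negbK; exact: row_length_leL.
Qed.

Section Weights.
Variables (R : comNzRingType) (x t : n.-tuple R).
Let w := lattice_weight (nth 0 x) (nth 0 t) n (part lam).

(** A frozen vertex of nonzero weight meets no horizontal line and has equal labels above and below,
    so the prescribed top labels descend through the missing vertices. *)
Lemma boundary_extended_state E : lattice_boundary n K top_row E.1 E.2 ->
  (forall r c, (r < K)%N -> (c < L)%N -> (r, c) \notin vertices lam ->
     w r c (cell E.2 r.+1 c) (cell E.1 r c.+1) (cell E.2 r c) (cell E.1 r c) != 0) ->
  extended_state E.
Proof.
move=> /lattice_boundaryP [bot top lr] w_neq0.
have frozen r c : (r < K)%N -> (c < L)%N -> (r, c) \notin vertices lam ->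
    cell E.2 r.+1 c = cell E.2 r c /\ cell E.1 r c = false.
  move=> rK cL v; have := w_neq0 r c rK cL v.
  move: v; rewrite mem_vertices rK /w /lattice_weight /row_length.
  case: ifP => [_|_]; first by rewrite cL.
  rewrite /jagged_row_weight /jagged_length /= => /negPf ->; rewrite /frozen_weight.
  case: and3P => [[/eqP -> _ /negPf ->] // | _]; by rewrite eqxx.
split=> // [r c rK | r c | r rK].
- rewrite ltnS leq_eqVlt => /predU1P [-> _ | cL v]; first by case: (lr r rK).
  by have [] := frozen r c rK cL v.
- rewrite ltnS => rK cL; rewrite -(subKn rK).
  elim: (K - r)%N => [|m IHm] v; first by rewrite subn0 top.
  (* Past [K] the truncated subtraction makes both row numbers 0, and the induction hypothesis is
     the goal. *)
  have [Km | mK] := leqP K m; first by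
    move: v IHm; rewrite !(eqP (leqW Km : _ == _)) (eqP (Km : _ == _)) => v; exact.
  have mK' : (K - m.+1 < K)%N by lia.
  rewrite -(frozen _ _ mK' cL v).1 subnSK //; apply: IHm.
  apply: contra v; rewrite !mem_vertices mK' /= => /andP [mK'' cm].
  have := @row_length_dec (K - m.+1); rewrite subnSK // => /(_ mK'') le_l.
  exact: leq_trans cm le_l.
by case: (lr r rK).
Qed.

Lemma vertex_weightE E r c : (r, c) \in vertices lam ->
  vertex_weight x t (labeling_of E) (r, c) =
  w r c (cell E.2 r.+1 c) (cell E.1 r c.+1) (cell E.2 r c) (cell E.1 r c).
Proof.
move=> v; rewrite /vertex_weight; have [-> -> -> ->] := labeling_ofE E v.
move: v; rewrite mem_vertices /row_length /w /lattice_weight /= => /andP [_].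
by case: ifP => // _ cl; rewrite /jagged_row_weight /jagged_length cl.
Qed.

Lemma frozen_weight_eq1 E r c : extended_state E -> (r < K)%N -> (c < L)%N ->
  (r, c) \notin vertices lam ->
  w r c (cell E.2 r.+1 c) (cell E.1 r c.+1) (cell E.2 r c) (cell E.1 r c) = 1.
Proof.
move=> [eh ev el eb] rK cL v.
have vS : (r, c.+1) \notin vertices lam.
  by apply: contra v; rewrite !mem_vertices => /andP [-> /ltnW].
have vr : (r.+1, c) \notin vertices lam.
  apply: contra v; rewrite !mem_vertices rK => /andP [rK' cl].
  exact: leq_trans cl (row_length_dec rK').
rewrite !ev ?eh // 1?ltnW //; move: v.
rewrite mem_vertices rK /w /lattice_weight /row_length.
case: ifP => [_|_]; first by rewrite cL.
by rewrite /jagged_row_weight /jagged_length /= => /negPf ->; rewrite /frozen_weight eqxx.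
Qed.

Lemma partition_functionE :
  partition_function lam x t
    = lattice_sum (nth 0 x) (nth 0 t) n (part lam) K top_row.
Proof.
transitivity (\sum_(s : labeling lam | boundary_ok s)
    \prod_(v <- vertices lam) vertex_weight x t s v).
  rewrite [RHS](bigID (fun s => all (fun v => vertex_weight x t s v != 0) (vertices lam))).
  rewrite [X in _ = _ + X]big1 ?addr0 // => s /andP [_ /allPn [v v_in]].
  by rewrite negbK => /eqP; exact: prod_seq_eq0.
rewrite (reindex_onto labeling_of tuples_of) => [|s _]; last exact: tuples_ofK.
rewrite lattice_sumE pair_big_dep /= big_mkcond [RHS]big_mkcond; apply: eq_bigr => E _ /=.
case: extended_stateP => [E_ext|E_not_ext].
  rewrite (extended_state_boundary E_ext) big_allpairs_dep.
  rewrite prod_iota; apply: eq_bigr => r _; rewrite prod_iota.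
  rewrite (big_ord_widen L
    (fun c => vertex_weight x t (labeling_of E) (r : nat, c))) ?row_length_leL //.
  rewrite big_mkcond.
  apply: eq_bigr => c _; case: ifP => [cl | /negP c_out].
    by rewrite vertex_weightE // mem_vertices ltn_ord.
  by apply/esym/frozen_weight_eq1 => //; rewrite mem_vertices ltn_ord; apply/negP.
case: ifP => // E_bdr; apply/esym.
have [/forallP ne0 | /forallPn [r /forallPn [c]]] := boolP
    [forall r : 'I_K, [forall c : 'I_L, ((r : nat, c : nat) \notin vertices lam) ==>
      (w r c (cell E.2 r.+1 c) (cell E.1 r c.+1) (cell E.2 r c) (cell E.1 r c) != 0)]].
  case: E_not_ext; apply: boundary_extended_state => // r c rK cL.
  by move/implyP: (forallP (ne0 (Ordinal rK)) (Ordinal cL)).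
rewrite negb_imply negbK /w => /andP [_ /eqP w0].
by rewrite (bigD1 r) //= (bigD1 c) //= w0 !mul0r.
Qed.

End Weights.
End PartitionFunction.

(** * Set-valued tableaux *)

Lemma prod_seq_sub (R : comNzRingType) (T : choiceType) (s : seq T) (F : T -> R) :
  uniq s -> \prod_(A : seq_sub s) F (val A) = \prod_(a <- s) F a.
Proof.
move=> s_uniq; rewrite -(big_enum _ _ _ (fun A => F (val A))) -(big_map val xpredT).
apply: perm_big; apply: uniq_perm => //.
  by rewrite map_inj_uniq ?enum_uniq //; exact: val_inj.
move=> a; apply/mapP/idP => [[A _ ->] | a_s]; first exact: valP.
by exists (SeqSub a_s); rewrite ?mem_enum.
Qed.

Section Layers.
Variables (n : nat) (lam : n.-tuple nat).
Variables (R : idomainType) (x t : nat -> R).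

Local Notation box := (seq_sub (boxes lam)).
Implicit Types (S M : {set box}) (A : box) (mu nu : nat -> nat).

Lemma mem_boxes i j : ((i, j) \in boxes lam) = (j < part lam i)%N.
Proof.
apply/allpairsPdep/idP => [[i' [j' [+ + [-> ->]]]] | ji].
  by rewrite !mem_iota.
exists i, j; rewrite !mem_iota /= add0n; split=> //.
by rewrite ltnNge; apply: contraL ji => ni; rewrite /part nth_default ?size_tuple.
Qed.

Lemma boxes_uniq : uniq (boxes lam).
Proof.
apply: allpairs_uniq_dep => [|i _|[i j] [i' j'] _ _ /= [-> ->] //]; exact: iota_uniq.
Qed.

Definition in_set_at S i j := [exists A in S, val A == (i, j)].

Lemma in_set_atE S A : in_set_at S (val A).1 (val A).2 = (A \in S).
Proof.
apply/exists_inP/idP => [[C CS /eqP]|AS]; last by exists A; rewrite // -surjective_pairing.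
by rewrite -surjective_pairing => /val_inj <-.
Qed.

(* Whether the set [M] of boxes containing [k] is compatible with the set [S] of
   boxes containing a label smaller than [k]. *)
Definition layer_ok S M :=
  [forall A in M, ~~ in_set_at S (val A).1 (val A).2.+1
                  && ~~ in_set_at (S :|: M) (val A).1.+1 (val A).2].

(** A box of [S] already holds a smaller label, so [k] is an extra entry there and brings a factor
    -t_i; the least label of a box brings none. *)
Definition layer_weight k S M :=
  \prod_(A in M) (x k * (if A \in S then - t (val A).1 else 1)).

Definition layer_sum k S S' :=
  \sum_(M | layer_ok S M && (S :|: M == S')) layer_weight k S M.

(** The generating function of the fillings of [S'] by labels below [m]. The intermediate sets are
    arbitrary; [layer_sum_neq0] shows that inside a diagram only diagrams contribute. *)
Fixpoint svt_sum m S' : R :=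
  if m is k.+1 then \sum_S layer_sum k S S' * svt_sum k S else (S' == set0)%:R.

(* Whether a label may be added to [A] when the set of filled boxes grows from [S]
   to [S']; this does not involve the choices made for the other boxes. *)
Definition box_in S S' A :=
  [&& A \in S', ~~ in_set_at S (val A).1 (val A).2.+1
    & ~~ in_set_at S' (val A).1.+1 (val A).2].

(** Once the union [S'] is fixed, the conditions on [M] concern each box separately, so the sum over
    [M] factors. The two summands are the cases of a box in [M] and of a box outside [M]. *)
Lemma layer_sum_prod k S S' :
  layer_sum k S S' = \prod_A
    ((box_in S S' A)%:R * (x k * (if A \in S then - t (val A).1 else 1))
     + ((A \in S') == (A \in S))%:R).
Proof.
rewrite bigA_distr /layer_sum big_mkcond; apply: eq_bigr => M _.
case: ifP => [/andP [/forall_inP M_ok /eqP <-] | M_ko].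
  rewrite [LHS]/layer_weight big_mkcond; apply: eq_bigr => A _; case: ifP => AM.
    by rewrite /box_in inE AM orbT (M_ok A AM) mul1r.
  by rewrite inE AM orbF eqxx.
apply/esym/eqP; move: M_ko; apply: contraFT => /prodf_neq0 M_neq0.
have M_eq : S :|: M = S'.
  apply/setP => A; have := M_neq0 A isT; rewrite inE; case: ifP => AM.
    by rewrite /box_in; case: (A \in S') => /=; rewrite ?orbT // mul0r eqxx.
  by case: (A \in S'); case: (A \in S); rewrite //= eqxx.
rewrite M_eq eqxx andbT; apply/forall_inP => A AM.
have := M_neq0 A isT; rewrite AM /box_in M_eq.
by case: and3P => [[_ -> ->] // | _]; rewrite mul0r eqxx.
Qed.

Definition diagram mu : {set box} := [set A | ((val A).2 < mu (val A).1)%N].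

Lemma in_diagram mu i j : (forall k, (mu k <= part lam k)%N) ->
  in_set_at (diagram mu) i j = (j < mu i)%N.
Proof.
move=> mu_lam; apply/exists_inP/idP => [[A] | ji].
  by rewrite inE => + /eqP A_ij; rewrite A_ij.
have ij : (i, j) \in boxes lam by rewrite mem_boxes (leq_trans ji).
by exists (SeqSub ij); rewrite ?inE.
Qed.

(** A box of nu / mu must receive the label and gives x_k. The last box of row i of mu may receive
    it when no box of nu lies below, giving 1 - t_i x_k. Every other box gives 1. *)
Lemma layer_sum_diagram k mu nu :
  (forall i, (nu i <= part lam i)%N) -> (forall i, (nu i.+1 <= mu i <= nu i)%N) ->
  layer_sum k (diagram mu) (diagram nu) = \prod_(i < n) (x k ^+ (nu i - mu i) *
     (if (nu i.+1 < mu i)%N then 1 - t i * x k else 1)).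
Proof.
move=> nu_lam mu_nu.
have mu_lam i : (mu i <= part lam i)%N.
  by have /andP [_ /leq_trans->] := mu_nu i.
rewrite layer_sum_prod.
pose f (a : nat * nat) := (if (mu a.1 <= a.2 < nu a.1)%N then x k else 1) *
  (if ((nu a.1.+1 < mu a.1) && (a.2.+1 == mu a.1))%N then 1 - t a.1 * x k else 1).
transitivity (\prod_(A : box) f (val A)).
  apply: eq_bigr => -[[i j] ij] _; rewrite /f /box_in !in_diagram // !inE /=.
  have /andP [nu_mu mu_nu_i] := mu_nu i.
  rewrite -!leqNgt.
  case: (ltnP j (mu i)) => [j_mu | mu_j].
    rewrite (leq_trans j_mu mu_nu_i) /= mul1r.
    case: (ltngtP j.+1 (mu i)) j_mu => //= [_ _ | <- _].
      by rewrite andbF mul0r add0r.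
    rewrite ltnS andbT; case: ifP => _; last by rewrite mul0r add0r.
    by rewrite mul1r addrC mulrN mulrC.
  rewrite [j.+1 == _]gtn_eqF ?ltnS // andbF /=; case: (ltnP j (nu i)) => j_nu /=.
    by rewrite (leqW mu_j) (leq_trans nu_mu mu_j) mul1r addr0.
  by rewrite mul0r add0r mulr1.
rewrite prod_seq_sub ?boxes_uniq // big_allpairs_dep prod_iota.
apply: eq_bigr => i _; rewrite prod_iota /f /= big_split /=; congr (_ * _).
  rewrite -big_mkcond /= -(big_mkord (fun j => (mu i <= j < nu i)%N) (fun=> x k)).
  have /andP [_ mu_nu_i] := mu_nu i.
  rewrite -(big_nat_widen 0 (nu i) _ (leq (mu i))) //.
  by rewrite -(big_nat_widenl (mu i) 0 (nu i) xpredT) // prodr_const_nat.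
case: (ltnP (nu i.+1) (mu i)) => [nu_mu | _] /=; last by rewrite big1.
have mu_i : ((mu i).-1 < part lam i)%N by have := mu_lam i; lia.
rewrite (bigD1 (Ordinal mu_i)) //= prednK ?eqxx ?big1 ?mulr1 //; last exact: leq_ltn_trans nu_mu.
move=> j; rewrite -(inj_eq val_inj) /= => j_mu.
by case: eqP => // j_eq; move: j_mu; rewrite -j_eq eqxx.
Qed.

Definition row_count S i := find (fun j => ~~ in_set_at S i j) (iota 0 (part lam i)).

Lemma row_count_le S i : (row_count S i <= part lam i)%N.
Proof. by rewrite -[leqRHS](size_iota 0) find_size. Qed.

Lemma lt_row_count S i j : (j < row_count S i)%N -> in_set_at S i j.
Proof.
move=> j_lt; have j_lam := leq_trans j_lt (row_count_le S i).
by have := before_find 0%N j_lt; rewrite nth_iota // add0n => /negbFE.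
Qed.

Lemma row_count_notin S i : ~~ in_set_at S i (row_count S i).
Proof.
have [rc_lam | rc_ge] := ltnP (row_count S i) (part lam i); last first.
  apply/existsPn => -[[i' j'] A]; rewrite negb_and; apply/orP; right => /=.
  by apply: contraTneq A => -[-> ->]; rewrite mem_boxes -leqNgt.
have h : has (fun j => ~~ in_set_at S i j) (iota 0 (part lam i)).
  by rewrite has_find size_iota.
by have := nth_find 0%N h; rewrite nth_iota // add0n.
Qed.

Lemma row_count_diagram mu i :
  (forall k, (mu k <= part lam k)%N) -> row_count (diagram mu) i = mu i.
Proof.
move=> mu_lam; have := row_count_notin (diagram mu) i; have := @lt_row_count (diagram mu) i (mu i).
by rewrite !in_diagram // ltnn -leqNgt; case: ltngtP => // _ /(_ isT).
Qed.

(** A box of nu outside [S] must receive the label. Hence no box of [S] is to its right, which makes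
    the rows of [S] left-justified, and no box of nu is below it, which makes the difference a
    horizontal strip. *)
Lemma layer_sum_neq0 k S nu :
  (forall i, (nu i <= part lam i)%N) -> (forall i, (nu i.+1 <= nu i)%N) ->
  layer_sum k S (diagram nu) != 0 ->
  S = diagram (row_count S) /\ (forall i, (nu i.+1 <= row_count S i <= nu i)%N).
Proof.
move=> nu_lam nu_dec; rewrite layer_sum_prod => /prodf_neq0 neq0.
have S_nu A : A \in S -> A \in diagram nu.
  move=> AS; have := neq0 A isT; rewrite AS /box_in.
  by case: (A \in diagram nu) => //=; rewrite mul0r addr0 eqxx.
have box_ok A : A \in diagram nu -> A \notin S ->
    ~~ in_set_at S (val A).1 (val A).2.+1 /\ (nu (val A).1.+1 <= (val A).2)%N.
  move=> A_nu /negPf AS; have := neq0 A isT; rewrite A_nu AS addr0 /box_in A_nu in_diagram //.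
  by rewrite -leqNgt /=; case: andP => [[]//|_] /=; rewrite mul0r eqxx.
have S_left i j : in_set_at S i j.+1 -> in_set_at S i j.
  case/exists_inP => C CS /eqP C_ij.
  have := S_nu C CS; rewrite inE C_ij /= => j_nu.
  have ij : (i, j) \in boxes lam by rewrite mem_boxes (leq_trans _ (nu_lam i)) // ltnW.
  have -> : in_set_at S i j = (SeqSub ij \in S) by rewrite -in_set_atE.
  apply: contraT => ij_S; have [|/negP ns _] := box_ok (SeqSub ij) _ ij_S.
    by rewrite inE /= ltnW.
  by case: ns; apply/exists_inP; exists C; rewrite // C_ij.
have S_leq i j j' : (j' <= j)%N -> in_set_at S i j -> in_set_at S i j'.
  elim: j => [|j IHj]; first by rewrite leqn0 => /eqP ->.
  by rewrite leq_eqVlt ltnS => /predU1P [-> // | /IHj{}IHj /S_left].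
have SE : S = diagram (row_count S).
  apply/setP => A; rewrite inE -in_set_atE; apply/idP/idP; last exact: lt_row_count.
  by move=> AS; rewrite ltnNge; apply: contra (row_count_notin S _) => /S_leq; apply.
split=> // i; apply/andP; split; rewrite leqNgt; apply/negP => lt.
  have lt_nu := leq_trans lt (nu_dec i).
  have ij : (i, row_count S i) \in boxes lam by rewrite mem_boxes (leq_trans lt_nu).
  have [||_ /=] := box_ok (SeqSub ij); first by rewrite inE.
    by rewrite -in_set_atE row_count_notin.
  by rewrite leqNgt lt.
have /exists_inP [C CS /eqP C_ij] := lt_row_count lt.
by have := S_nu C CS; rewrite inE C_ij ltnn.
Qed.

Lemma diagram_eq0 mu : (forall i, (mu i <= part lam i)%N) ->
  (forall i, (mu i.+1 <= mu i)%N) -> (diagram mu == set0) = (mu 0%N == 0%N).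
Proof.
move=> mu_lam mu_dec; apply/eqP/eqP => [mu0 | mu0].
  apply/eqP; rewrite -leqn0 leqNgt -in_diagram // mu0; apply/exists_inP => -[A].
  by rewrite inE.
have mu_eq0 i : mu i = 0%N by elim: i => // i IHi; apply/eqP; rewrite -leqn0 -IHi.
by apply/setP => A; rewrite !inE mu_eq0.
Qed.

Lemma diagram_part : diagram (part lam) = setT.
Proof.
by apply/setP => -[[i j] ij]; rewrite !inE -mem_boxes.
Qed.

Hypothesis reg : forall i j, (i < n)%N -> (j < n)%N -> 1 - t i * x j != 0.

(** Induction on the number of labels, by the branching rule. The value 0 occurs when nu has more
    than m rows, too many for a strictly increasing first column. *)
Lemma svt_sum_diagram m nu : (m <= n)%N -> (forall i, (nu i <= part lam i)%N) ->
  (forall i, (nu i.+1 <= nu i)%N) ->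
  svt_sum m (diagram nu) = if nu m == 0%N then jt_det x t m nu else 0.
Proof.
elim: m nu => [|m IHm] nu m_n nu_lam nu_dec /=.
  by rewrite diagram_eq0 // /jt_det det_mx00; case: eqP.
have interl_dec mu : (forall i, (nu i.+1 <= mu i <= nu i)%N) ->
    (forall i, (mu i <= part lam i)%N) /\ (forall i, (mu i.+1 <= mu i)%N).
  move=> mu_nu; split=> i; have /andP [nu_mu mu_nu_i] := mu_nu i.
    exact: leq_trans mu_nu_i (nu_lam i).
  by have /andP [_ /leq_trans] := mu_nu i.+1; apply.
have term_neq0 S : layer_sum m S (diagram nu) * svt_sum m S != 0 ->
    [/\ S = diagram (row_count S), forall i, (nu i.+1 <= row_count S i <= nu i)%N
      & row_count S m = 0%N].
  rewrite mulf_eq0 negb_or => /andP [/(layer_sum_neq0 nu_lam nu_dec) [SE mu_nu]].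
  have [mu_lam mu_dec] := interl_dec _ mu_nu.
  by rewrite {1}SE IHm 1?ltnW //; case: (_ =P 0%N) => // _; rewrite eqxx.
case: eqP => nu_m; last first.
  apply: big1 => S _; apply/eqP; apply: contraT => /term_neq0 [_ mu_nu mu_m].
  by have := mu_nu m; rewrite mu_m leqn0 => /andP [/eqP].
have nu_eq0 i : (m < i)%N -> nu i = 0%N.
  elim: i => // i IHi; rewrite ltnS leq_eqVlt => /predU1P [<- // | /IHi nu_i].
  by apply/eqP; rewrite -leqn0 -nu_i.
have nu_le0 i : (nu i <= nu 0%N)%N by elim: i => // i; apply: leq_trans.
rewrite (@jt_det_branching _ _ _ _ _ (nu 0%N).+1) // => [|j jm]; last first.
  by apply: reg => //; exact: ltn_trans m_n.
pose mu_of S : {ffun 'I_m -> 'I_(nu 0%N).+1} := [ffun j : 'I_m => inord (row_count S j)].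
pose interl (mu : {ffun 'I_m -> 'I_(nu 0%N).+1}) :=
  [forall j : 'I_m, nu j.+1 <= mu j <= nu j]%N.
have interl_nat (u : {ffun 'I_m -> 'I_(nu 0%N).+1}) :
    interl u -> forall i, (nu i.+1 <= nat_fun u i <= nu i)%N.
  move=> /forallP mu_nu i; have [im | mi] := ltnP i m.
    by have := mu_nu (Ordinal im); rewrite -nat_funE.
  by rewrite nat_fun_default // nu_eq0.
(* The good sets correspond to the interlacing functions on the first m rows, through [row_count];
   all other sets contribute 0. *)
pose good S := (diagram (nat_fun (mu_of S)) == S) && interl (mu_of S).
rewrite (bigID good) /= [X in _ + X]big1 ?addr0 => [|S /negP S_bad]; last first.
  apply/eqP; apply: contraT => /term_neq0 [SE mu_nu mu_m]; case: S_bad.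
  have [mu_lam mu_dec] := interl_dec _ mu_nu.
  have mu_ofE (j : 'I_m) : mu_of S j = row_count S j :> nat.
    rewrite ffunE inordK // ltnS; have /andP [_ /leq_trans->//] := mu_nu j.
  apply/andP; split; last by apply/forallP => j; rewrite mu_ofE.
  rewrite {2}SE; apply/eqP/setP => A; rewrite !inE; congr (_ < _)%N.
  have [im | mi] := ltnP (val A).1 m; first by rewrite (nat_funE _ (Ordinal im)) mu_ofE.
  rewrite nat_fun_default //; apply/esym/eqP; rewrite -leqn0 -mu_m.
  elim: (val A).1 mi => [|i IHi]; first by rewrite leqn0 => /eqP ->.
  by rewrite leq_eqVlt ltnS => /predU1P [-> // | /IHi]; apply: leq_trans.
rewrite (reindex_onto (fun u => diagram (nat_fun u)) mu_of) => [|S /andP [/eqP ->] //].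
have mu_ofK (u : {ffun 'I_m -> 'I_(nu 0%N).+1}) :
    interl u -> mu_of (diagram (nat_fun u)) = u.
  move=> mu_int; have [mu_lam _] := interl_dec _ (interl_nat _ mu_int).
  apply/ffunP => j; apply: val_inj; rewrite ffunE /= row_count_diagram // nat_funE.
  by rewrite inordK.
apply: eq_big => [u | u /andP [/andP [_ mu_int] /eqP mu_E]].
  apply/andP/idP => [[/andP [_ +] /eqP mu_E] | mu_int]; first by rewrite mu_E.
  by rewrite /good mu_ofK // !eqxx.
rewrite mu_E in mu_int; have mu_nu := interl_nat _ mu_int.
have [mu_lam mu_dec] := interl_dec _ mu_nu.
rewrite layer_sum_diagram // IHm 1?ltnW // nat_fun_default // eqxx; congr (_ * _).
(* Row m contributes x_m^(nu_m), the isolated power in the branching rule, and the empty rows after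
   it contribute 1. *)
pose F i := x m ^+ (nu i - nat_fun u i) *
  (if (nu i.+1 < nat_fun u i)%N then 1 - t i * x m else 1).
transitivity (\prod_(i < m.+1) F i).
  rewrite (big_ord_widen n F m_n) [RHS]big_mkcond; apply: eq_bigr => i _.
  case: (ltnP i m.+1) => // mi; rewrite nat_fun_default; last exact: ltnW.
  by rewrite nu_eq0 // expr0 mulr1.
rewrite big_ord_recr /= mulrC {1}/F nat_fun_default // subn0 mulr1; congr (_ * _).
by apply: eq_bigr => j _; rewrite /F nat_funE.
Qed.

End Layers.

(** * Tableaux as sequences of label layers *)

Section Layers.
Variables (n : nat) (lam : n.-tuple nat).
Variables (R : idomainType).

Local Notation box := (seq_sub (boxes lam)).
Implicit Types (S M : {set box}) (A : box).

(* [nth set0 Ms j] stands for the set of boxes containing the label [j]. *)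
Definition below (Ms : seq {set box}) k : {set box} := \bigcup_(j < k) nth set0 Ms j.

Lemma belowP (Ms : seq {set box}) k A :
  reflect (exists2 j, (j < k)%N & A \in nth set0 Ms j) (A \in below Ms k).
Proof.
apply: (iffP bigcupP) => [[j _ Aj] | [j jk Aj]]; first by exists j.
by exists (Ordinal jk).
Qed.

Lemma below_rcons (Ms : seq {set box}) M k : (k <= size Ms)%N ->
  below (rcons Ms M) k = below Ms k.
Proof.
move=> k_sz; apply: eq_bigr => j _.
by rewrite nth_rcons (leq_trans (ltn_ord j)).
Qed.

Definition layers_ok (Ms : seq {set box}) :=
  all (fun k => layer_ok (below Ms k) (nth set0 Ms k)) (iota 0 (size Ms)).

Lemma layers_ok_rcons (Ms : seq {set box}) M :
  layers_ok (rcons Ms M) = layers_ok Ms && layer_ok (below Ms (size Ms)) M.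
Proof.
rewrite /layers_ok size_rcons -addn1 iotaD all_cat /= andbT.
rewrite nth_rcons ltnn eqxx below_rcons //; congr (_ && _).
apply: eq_in_all => k; rewrite mem_iota /= add0n => k_sz.
by rewrite below_rcons ?nth_rcons ?k_sz // ltnW.
Qed.

Lemma svt_sumE (x t : nat -> R) m S :
  svt_sum x t m S = \sum_(Ms : m.-tuple {set box} | layers_ok Ms && (below Ms m == S))
    \prod_(k < m) layer_weight x t k (below Ms k) (nth set0 Ms k).
Proof.
elim: m S => [|m IHm] S /=.
  rewrite big_mkcond big_tuple0 /= big_ord0 /below big_ord0 eq_sym.
  by rewrite /layers_ok /=; case: eqP.
rewrite [RHS]big_mkcond [RHS]big_tuple_rcons.
under eq_bigr => S0 _ do rewrite IHm mulr_sumr big_mkcond.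
rewrite exchange_big; apply: eq_bigr => Ms _ /=.
rewrite (bigD1 (below Ms m)) //= [X in _ + X = _]big1 ?addr0; last first.
  by move=> S0 /negPf; rewrite eq_sym => ->; rewrite andbF.
rewrite eqxx andbT /layer_sum big_mkcond /=.
case: (boolP (layers_ok Ms)) => Ms_ok; last first.
  by rewrite big1 // => M _; rewrite layers_ok_rcons (negPf Ms_ok).
rewrite mulr_suml; apply: eq_bigr => M _.
rewrite layers_ok_rcons Ms_ok size_tuple /=.
rewrite [below (rcons Ms M) _]big_ord_recr /= -/(below _ _) nth_rcons size_tuple ltnn eqxx.
rewrite below_rcons ?size_tuple //; case: ifP => _; last by rewrite mul0r.
rewrite big_ord_recr /= mulrC nth_rcons size_tuple ltnn eqxx below_rcons ?size_tuple //.
congr (_ * _); apply: eq_bigr => k _.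
by rewrite nth_rcons size_tuple ltn_ord below_rcons // size_tuple ltnW.
Qed.

Definition layers_of (T : filling n lam) : n.-tuple {set box} :=
  [tuple [set A | k \in T A] | k < n].

Definition filling_of (Ms : n.-tuple {set box}) : filling n lam :=
  [ffun A => [set k | A \in tnth Ms k]].

Lemma layers_ofK : cancel layers_of filling_of.
Proof.
by move=> T; apply/ffunP => A; apply/setP => k; rewrite ffunE !inE tnth_mktuple inE.
Qed.

Lemma filling_ofK : cancel filling_of layers_of.
Proof.
move=> Ms; apply: eq_from_tnth => k; rewrite tnth_mktuple.
by apply/setP => A; rewrite inE ffunE inE.
Qed.

Lemma mem_layer (T : filling n lam) (k : 'I_n) A :
  (A \in nth set0 (layers_of T) k) = (k \in T A).
Proof. by rewrite -tnth_nth tnth_mktuple inE. Qed.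

Lemma below_layersP (T : filling n lam) k A : (k <= n)%N ->
  reflect (exists2 j : 'I_n, (j < k)%N & j \in T A) (A \in below (layers_of T) k).
Proof.
move=> kn; apply: (iffP (belowP _ _ _)) => [[j jk] | [j jk jT]].
  by rewrite (mem_layer T (Ordinal (leq_trans jk kn))); exists (Ordinal (leq_trans jk kn)).
by exists j; rewrite ?mem_layer.
Qed.

Lemma set_max_leP (X : {set 'I_n}) (m : nat) :
  reflect (forall k, k \in X -> (k <= m)%N) (set_max X <= m)%N.
Proof. exact: bigmax_leqP. Qed.

Lemma leq_set_minP (X : {set 'I_n}) (m : nat) : (m <= n)%N ->
  reflect (forall k, k \in X -> (m <= k)%N) (m <= set_min X)%N.
Proof.
move=> mn; apply: (iffP idP) => [m_le k kX | X_ge].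
  apply: leq_trans m_le _; rewrite /set_min.
  elim: (index_enum _) (mem_index_enum k) => // a r IHr; rewrite inE big_cons.
  case/predU1P => [<- | /IHr]; first by rewrite kX geq_minl.
  by case: ifP => // _; exact: leq_trans (geq_minr _ _).
rewrite /set_min; elim/big_ind: _ => // a b; by rewrite leq_min => -> ->.
Qed.

Lemma set_max_leq_set_min (X Y : {set 'I_n}) : reflect
  (forall k j, k \in X -> j \in Y -> (k <= j)%N) (set_max X <= set_min Y)%N.
Proof.
have Xn : (set_max X <= n)%N by apply/set_max_leP => k _; exact: ltnW.
apply: (iffP (leq_set_minP _ Xn)) => [max_le k j kX jY | XY j jY].
  by apply: leq_trans (max_le j jY); apply/(set_max_leP X).
by apply/set_max_leP => k kX; exact: XY.
Qed.

(** An empty [X] has maximum 0, which is not below the minimum of a [Y] containing 0. An empty [Y]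
    causes no trouble: its minimum [n] exceeds every label. *)
Lemma set_max_ltn_set_min (X Y : {set 'I_n}) : X != set0 -> reflect
  (forall k j, k \in X -> j \in Y -> (k < j)%N) (set_max X < set_min Y)%N.
Proof.
rewrite -card_gt0 => /(eq_bigmax_cond (fun k : 'I_n => k : nat)) X_max.
have Xn : (set_max X < n)%N by rewrite /set_max; have [k _ ->] := X_max.
apply: (iffP (leq_set_minP _ Xn)) => [max_lt k j kX jY | XY j jY].
  by apply: leq_ltn_trans (max_lt j jY); apply/(set_max_leP X).
by rewrite /set_max; have [k kX ->] := X_max; exact: XY.
Qed.

(** Both orderings are tested one label k at a time: a box containing k has no label smaller than k
    in the box to its right, and none smaller than or equal to k in the box below. *)
Lemma is_svt_layers (T : filling n lam) :
  is_svt T = layers_ok (layers_of T) && (below (layers_of T) n == setT).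
Proof.
have T_neq0 : [forall A, T A != set0] = (below (layers_of T) n == setT).
  apply/forallP/eqP => [T0 | bT A].
    apply/setP => A; rewrite inE; apply/below_layersP => //.
    by have /set0Pn [j] := T0 A; exists j.
  have : A \in below (layers_of T) n by rewrite bT inE.
  by case/below_layersP => // j _ jT; apply/set0Pn; exists j.
rewrite /is_svt T_neq0 andbC; case: (boolP (_ == setT)) => bT; rewrite ?andbT ?andbF //.
rewrite -T_neq0 in bT; move/forallP: bT => T0.
apply/andP/allP => [[/forallP row /forallP col] k | ok].
  rewrite size_tuple mem_iota add0n => /= kn; apply/forall_inP => A.
  rewrite (mem_layer T (Ordinal kn)) => kA; apply/andP; split.
    apply/exists_inP => -[C /(below_layersP T C (ltnW kn)) [j jk jC] CA].
    have /implyP/(_ CA)/set_max_leq_set_min/(_ _ _ kA jC) := forallP (row A) C.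
    by rewrite leqNgt jk.
  apply/exists_inP => -[C C_in CA].
  have /implyP/(_ CA)/(set_max_ltn_set_min _ (T0 A)) lt := forallP (col A) C.
  move: C_in; rewrite inE (mem_layer T (Ordinal kn)) => /orP [].
    case/(below_layersP T C (ltnW kn)) => j jk /(lt _ _ kA).
    by rewrite /= ltnNge ltnW.
  by move/(lt _ _ kA); rewrite ltnn.
have layer k : layer_ok (below (layers_of T) k) (nth set0 (layers_of T) k) || (n <= k)%N.
  by case: ltnP => [kn|]; rewrite ?orbT // ok // size_tuple mem_iota.
split; apply/forallP => A; apply/forallP => C; apply/implyP => CA.
  apply/set_max_leq_set_min => k j kA jC; rewrite leqNgt; apply/negP => jk.
  have := layer k; rewrite leqNgt ltn_ord orbF => /forall_inP/(_ A).
  rewrite mem_layer => /(_ kA)/andP [/negP no_right _]; apply: no_right.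
  apply/exists_inP; exists C => //.
  by apply/below_layersP; [exact: ltnW | exists j].
apply/(set_max_ltn_set_min _ (T0 A)) => k j kA jC; rewrite ltnNge; apply/negP => jk.
have := layer k; rewrite leqNgt ltn_ord orbF => /forall_inP/(_ A).
rewrite mem_layer => /(_ kA)/andP [_ /negP no_below]; apply: no_below.
apply/exists_inP; exists C => //.
rewrite inE mem_layer; move: jk; rewrite leq_eqVlt => /predU1P [/val_inj <- | jk].
  by rewrite jC orbT.
by apply/orP; left; apply/below_layersP; [exact: ltnW | exists j].
Qed.

(** Only the least label of a box has no smaller one beside it; the others are those with a factor
    -t_i in [layer_weight]. *)
Lemma card_repeated_labels (T : filling n lam) A : T A != set0 ->
  #|[set k in T A | A \in below (layers_of T) k]| = (#|T A| - 1)%N.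
Proof.
case/set0Pn => k0 k0A; case: (arg_minnP (fun k : 'I_n => k : nat) k0A) => m m_in m_min.
have mA : m \in T A := m_in.
rewrite (cardsD1 m (T A)) mA add1n subn1 /=; apply: eq_card => k; rewrite !inE.
case kA: (k \in T A); rewrite ?andbF //= andbT.
apply/below_layersP/idP => [|[j jk jA] | km]; first exact: ltnW.
  by apply: contraTneq jk => ->; rewrite -leqNgt m_min.
by exists m => //; rewrite ltn_neqAle m_min // andbT eq_sym.
Qed.

Variables (x t : n.-tuple R).

Lemma svt_weight_layers (T : filling n lam) : is_svt T ->
  (\prod_(i < n) (- t`_i) ^+ excess T i) * (\prod_(k < n) x`_k ^+ occurrences T k) =
  \prod_(k < n) layer_weight (nth 0 x) (nth 0 t) k (below (layers_of T) k)
    (nth set0 (layers_of T) k).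
Proof.
case/and3P => /forallP T0 _ _.
rewrite /layer_weight; under [RHS]eq_bigr => k _ do rewrite big_split /=.
rewrite big_split /= mulrC; congr (_ * _).
  apply: eq_bigr => k _; rewrite prodr_const; congr (_ ^+ _).
  by apply: eq_card => A; rewrite inE -mem_layer.
under [RHS]eq_bigr => k _ do rewrite big_mkcond.
rewrite exchange_big /=.
(* No box is empty, so the truncated difference in [excess] is the sum of [#|T A| - 1] over the
   boxes of the row. *)
transitivity (\prod_(A : box) (- t`_(val A).1) ^+ (#|T A| - 1)).
  have row_lt A : ((val A).1 < n)%N.
    case: A => -[i j] /= /allpairsPdep [i' [j' [+ _ [-> _]]]].
    by rewrite mem_iota.
  rewrite [RHS](partition_big (fun A => Ordinal (row_lt A)) xpredT) //=.
  apply: eq_bigr => i _.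
  rewrite (eq_bigr (fun A => (- t`_i) ^+ (#|T A| - 1))) => [|A /eqP <- //].
  rewrite prodrXr /excess; congr (_ ^+ _).
  rewrite -sum1_card -sumnB => [|A _]; last by rewrite card_gt0.
  by apply: eq_bigl => A; rewrite -(inj_eq val_inj).
apply: eq_bigr => A _; rewrite -card_repeated_labels // -prodr_const [LHS]big_mkcond.
apply: eq_bigr => k _; rewrite inE mem_layer; case: (k \in T A) => //=.
Qed.

Lemma refined_grothendieckE :
  refined_grothendieck lam x t = svt_sum (nth 0 x) (nth 0 t) n [set: box].
Proof.
rewrite svt_sumE (reindex layers_of); last first.
  by exists filling_of => T _; [exact: layers_ofK | exact: filling_ofK].
rewrite /refined_grothendieck; apply: eq_big => T; first exact: is_svt_layers.
exact: svt_weight_layers.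
Qed.

End Layers.

(** Evaluation at 0 gives 1. This provides the nonzero factors cancelled in the branching rule. *)
Lemma one_subMX_neq0 n (i j : 'I_n) : 1 - 'X_i * 'X_j != 0 :> {mpoly int[n]}.
Proof.
apply/eqP => /(congr1 (meval (fun=> 0))).
by rewrite mevalB mevalM meval1 !mevalXU meval0 mulr0 subr0 => /eqP; rewrite oner_eq0.
Qed.

Theorem theorem5p5 (n : nat) (lam : n.-tuple nat) :
  is_partition lam ->
  partition_function lam (x_vars n) (t_vars n) =
    refined_grothendieck lam (x_vars n) (t_vars n).
Proof.
move=> lam_part; rewrite partition_functionE // lattice_sum_top //; last first.
- by move=> c cL; rewrite (nth_mktuple_lt _ _ cL).
- by move=> i j; exact: part_dec.
(* The set of all boxes is the diagram of [lam], and [part lam n] is the default 0, so the tableau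
   sum is the determinant. *)
rewrite refined_grothendieckE -diagram_part svt_sum_diagram //.
- by rewrite /part nth_default ?size_tuple.
- move=> i j i_n j_n.
  by rewrite (nth_mktuple_lt _ _ i_n) (nth_mktuple_lt _ _ j_n) one_subMX_neq0.
by move=> i; exact: part_dec.
Qed.
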